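(* Let $\alpha\in(0,2)$, $\alpha\ne1$, let $W_j\sim\mathcal{N}(0,\sigma_W^2)$ with $\sigma_W>0$, and let $c>1$. With $X$ and $X_{(0,c)}$ as in the context, the Kolmogorov distance $\Delta(X,X_{(0,c)}):=\sup_{x\in\mathbb{R}}|\mathbb{P}(X\le x)-\mathbb{P}(X_{(0,c)}\le x)|$ satisfies $$\Delta(X,X_{(0,c)})\le B_6(c,\alpha):=\frac{e^{-1/2}}{\sqrt{2\pi}}\sqrt{\Gamma\!\left(\frac{\alpha+4}{\alpha}\right)\left(\frac{\alpha}{4-\alpha}c^{\frac{\alpha-4}{\alpha}}+\left(\frac{\alpha}{2-\alpha}c^{\frac{\alpha-2}{\alpha}}\right)^2\right)},$$ where $\Gamma(\cdot)$ is the gamma function.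
   Context: Let $\{\Gamma_j\}_{j\ge1}$ be the successive arrival times of a unit rate Poisson process on $(0,\infty)$ and let $\{W_j\}_{j\ge1}$ be i.i.d. $\mathcal{N}(0,\sigma_W^2)$ independent of $\{\Gamma_j\}$. Let $X=\sum_{j=1}^\infty W_j\Gamma_j^{-1/\alpha}$ (a convergent series); $X$ has the symmetric $\alpha$-stable law with characteristic function $\exp(-\sigma^\alpha|s|^\alpha)$, where $\sigma^\alpha=\mathbb{E}[|W_1|^\alpha]/C_\alpha$ and $C_\alpha=\frac{1-\alpha}{\Gamma(2-\alpha)\cos(\pi\alpha/2)}$. For $c>0$ let $X_{(0,c)}:=\sum_{j:\Gamma_j\in[0,c]}W_j\Gamma_j^{-1/\alpha}$, with the convention that an empty sum is $0$. *)

(* Defs.v *)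
From HB Require Import structures.
From mathcomp Require Import all_boot all_order all_algebra finmap.
From mathcomp Require Import all_classical all_reals all_analysis.
From mathcomp Require Import measurable_realfun.

Set Implicit Arguments.
Unset Strict Implicit.
Unset Printing Implicit Defensive.

Import Order.TTheory GRing.Theory Num.Theory.
Import numFieldNormedType.Exports.

Local Open Scope classical_set_scope.
Local Open Scope ring_scope.

Section independence.
Context d (T : measurableType d) (R : realType) (P : probability T R).

Definition independent_events (I : choiceType) (E : I -> set T) : Prop :=
  forall J : {fset I},
    P (\bigcap_(i in [set` J]) E i) = (\prod_(i <- J) fine (P (E i)))%:E.

Definition independent_RVs (I : choiceType) (X : I -> {RV P >-> R}) : Prop :=
  forall A : I -> set R, (forall i, measurable (A i)) ->
    independent_events (fun i => X i @^-1` A i).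

Definition generated_sigma_algebra (I : Type) (X : I -> {RV P >-> R}) :
    set (set T) :=
  <<s \bigcup_(i in [set: I]) preimage_set_system setT (X i) measurable >>.

(* Independence of the sigma-algebras sigma(X_i, i in I) and sigma(Y_j, j in J);
   nothing is required of the members of one family among themselves. *)
Definition independent_families (I J : Type)
    (X : I -> {RV P >-> R}) (Y : J -> {RV P >-> R}) : Prop :=
  forall A B : set T,
    generated_sigma_algebra X A -> generated_sigma_algebra Y B ->
    P (A `&` B) = (P A * P B)%E.

End independence.

Section poisson_process.
Context d (T : measurableType d) (R : realType) (P : probability T R).

(* The event that exactly k of the points G 0, G 1, ... lie in A. *)
Definition count_event (G : nat -> {RV P >-> R}) (A : set R) (k : nat) :
    set T :=
  [set w | [set j | A (G j w)] #= `I_k]%card.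

(* G 0 is the first arrival. The numbers of arrivals in the intervals ]a, b]
   are the increments of the counting process t |-> #{j | G j <= t}. *)
Record unit_poisson_arrivals (G : nat -> {RV P >-> R}) : Prop := {
  arrivals_increasing :
    {ae P, forall w, 0 < G 0%N w /\ forall j, G j w < G j.+1 w} ;
  poisson_increments : forall (a b : R) (k : nat), 0 <= a -> a < b ->
    P (count_event G `]a, b] k) = (poisson_pmf (b - a) k)%:E ;
  independent_increments :
    forall (n : nat) (a b : 'I_n -> R) (k : 'I_n -> nat),
      (forall i, 0 <= a i < b i) ->
      trivIset setT (fun i => [set` `]a i, b i]]) ->
      independent_events P (fun i => count_event G `]a i, b i] (k i)) }.

End poisson_process.

Section poisson_series.
Context d (T : measurableType d) (R : realType) (P : probability T R).

Definition poisson_series_term (W G : nat -> {RV P >-> R}) (alpha : R)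
    (j : nat) (w : T) : R :=
  W j w * G j w `^ (- alpha^-1).

(* Almost surely only finitely many arrivals are at most c; on the remaining
   null set the finitely supported sum may take its default value 0. *)
Definition truncated_poisson_series (W G : nat -> {RV P >-> R}) (alpha c : R)
    (w : T) : R :=
  \sum_(j \in [set j | 0 <= G j w <= c]) poisson_series_term W G alpha j w.

Lemma measurable_poisson_series_term W G alpha j :
  measurable_fun setT (poisson_series_term W G alpha j).
Proof.
apply: measurable_funM => //.
apply: (measurableT_comp (f := @powR R ^~ (- alpha^-1))) => //.
Qed.

Lemma measurable_truncated_poisson_series W G alpha c :
  measurable_fun setT (truncated_poisson_series W G alpha c).
Proof.
pose g j w : R := poisson_series_term W G alpha j w *
  \1_(G j @^-1` `[0, c]) w.
have mg j : measurable_fun setT (g j).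
  apply: measurable_funM; first exact: measurable_poisson_series_term.
  by apply: measurable_indic; exact: measurable_funPTI.
have gE w : truncated_poisson_series W G alpha c w = \sum_(j \in setT) g j w.
  rewrite /truncated_poisson_series fsbig_mkcond/=; apply: eq_fsbigr => j _.
  rewrite patchE /g indicE.
  rewrite (_ : (j \in _) = (w \in G j @^-1` `[0, c])).
    by case: (_ \in _); rewrite ?mulr1 ?mulr0.
  by apply: asbool_equiv_eq; rewrite /= in_itv.
pose F := \bigcup_n \bigcap_(j in [set j | (n <= j)%N]) (g j @^-1` [set 0]).
have mF : measurable F.
  apply: bigcup_measurable => n _; apply: bigcap_measurableType => j _.
  by rewrite -[X in measurable X]setTI; exact: mg.
pose h n w := (\sum_(j < n) g j w) * \1_F w.
apply: (@measurable_fun_cvg _ _ _ _ h).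
  move=> n; apply: measurable_funM; last exact: measurable_indic.
  exact: measurable_sum.
move=> w _; rewrite gE /h indicE; have [wF|wF] := boolP (w \in F).
  have [n _ gn] := set_mem wF.
  have gn0 j : (n <= j)%N -> g j w = 0 by move=> nj; exact: gn.
  apply: cvg_near_cst; near=> m; rewrite mulr1.
  rewrite (@fsbigE _ _ _ _ _ (iota 0 m)) ?iota_uniq//; last first.
    move=> j _; rewrite mem_iota add0n/= -leqNgt => mj; apply: gn0.
    by apply: leq_trans mj; near: m; exact: nbhs_infty_ge.
  by rewrite -(big_mkord xpredT (g ^~ w)) /index_iota subn0;
    apply: eq_bigl => j; rewrite in_setT.
suff -> : \sum_(j \in setT) g j w = 0.
  by under eq_fun do rewrite mulr0; exact: cvg_cst.
rewrite no_finite_support ?big_nil//= => /finite_seqP[s sE].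
move/negP: wF; apply; apply/mem_set.
exists (\max_(j <- s) j).+1 => // j /= sj; apply: contrapT => gj.
have : [set` s] j by rewrite -sE.
by move=> /= js; move: sj; rewrite ltnNge leq_bigmax_seq.
Unshelve. all: by end_near. Qed.

HB.instance Definition _ W G alpha c :=
  isMeasurableFun.Build _ _ _ _ (truncated_poisson_series W G alpha c)
    (measurable_truncated_poisson_series W G alpha c).

End poisson_series.

Definition kolmogorov_distance d (T : measurableType d) (R : realType)
    (P : probability T R) (X Y : {RV P >-> R}) : \bar R :=
  ereal_sup [set `|cdf X x - cdf Y x|%E | x in [set: R]].

Definition Gamma_fun (R : realType) (a : R) : R :=
  \int[lebesgue_measure]_(x in `]0, +oo[) (x `^ (a - 1) * expR (- x)).

Definition truncation_bound (R : realType) (c alpha : R) : R :=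
  expR (- 2^-1) / Num.sqrt (2 * pi) *
  Num.sqrt (Gamma_fun ((alpha + 4) / alpha) *
    (alpha / (4 - alpha) * c `^ ((alpha - 4) / alpha) +
     (alpha / (2 - alpha) * c `^ ((alpha - 2) / alpha)) ^+ 2)).

(* Main.v *)
Require Import Defs.
From HB Require Import structures.
From mathcomp Require Import all_boot all_order all_algebra.
From mathcomp Require Import finmap.
From mathcomp Require Import all_classical all_reals all_analysis.
From mathcomp Require Import measurable_realfun.
From mathcomp Require Import ring lra.

(* Condition on the arrival times. Every partial sum of the series is then a
   centred Gaussian variable of variance proportional to
   V_n = \sum_(j < n) G_j^(-2/alpha), and the corresponding truncated sum is one
   whose variance is proportional to the part V'_n of V_n carried by the arrivals
   G_j <= c. Since |x| exp(-x^2/2) <= exp(-1/2), two such distribution functions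
   differ by at most K (V_n - V'_n) / (2 V'_n), where
   K = exp(-1/2) / sqrt(2 pi). If G_0 <= c then 1 / V'_n <= G_0^(2/alpha);
   otherwise V'_n = 0 and the difference is at most 1/2. Taking expectations, by
   Cauchy-Schwarz the first case contributes at most half of the bound, because
   E[G_0^(4/alpha)] = Gamma(4/alpha + 1) and because the second moment of
   \sum_(j | c < G_j) G_j^(-2/alpha) is the sum of the integral of x^(-4/alpha)
   over [c, +oo[ and of the square of the integral of x^(-2/alpha). The second
   case contributes exp(-c) / 2, which is at most the other half. Finally the
   bound passes to the almost sure limits of the partial sums. *)

Set Implicit Arguments.
Unset Strict Implicit.
Unset Printing Implicit Defensive.

Import Order.TTheory GRing.Theory Num.Theory.
Import numFieldNormedType.Exports.

Local Open Scope classical_set_scope.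
Local Open Scope ring_scope.

(** * Real inequalities *)

Section real_inequalities.
Context {R : realType}.
Implicit Types x h p q : R.

(** The obstacle is the division by V'_n. With positive probability no arrival is at most c; the
    truncated sum is then concentrated at 0, and no estimate between two Gaussian densities applies.
    Room for this event comes from the step that removes the square roots: for a ratio r of standard
    deviations, r - 1 <= (r^2 - 1) / 2. It makes the error linear in V_n - V'_n, and its factor 1/2
    leaves half of the bound unspent. That exp(-c) fits into the whole bound has to hold for every c
    > 1 and every alpha in ]0, 2[, so the gamma factor needs a lower bound explicit in c. Markov's
    inequality for G_0 provides it, and what remains is a numerical inequality in 4 / alpha.
    Conditioning on the arrivals is carried out by Fubini's theorem on a product of two copies of
    the sample space, each with the sigma-algebra of one family. The process is known through its
    increments only, so the second moment of the sum over late arrivals is computed from the numbers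
    of arrivals in the cells of a grid whose mesh tends to 0. *)

Lemma expR1_le : expR 1 <= 14 / 5 :> R.
Proof.
(* The tangent inequality 1 + x <= exp x at a small x is raised to a power, which leaves rational
   arithmetic. The two bounds on [ln 2] below arise in the same way. *)
have h : 31 / 32 <= expR (- (1 / 32)) :> R.
  by have := expR_ge1Dx (- (1 / 32) : R); lra.
have h2 : (31 / 32) ^+ 32 <= expR (- (1 / 32)) ^+ 32 :> R.
  by apply: lerXn2r => //; rewrite nnegrE; [lra|exact: expR_ge0].
rewrite -expRM_natl mulrN mul1r mulfV ?pnatr_eq0// expRN in h2.
have h3 : 5 / 14 <= (31 / 32) ^+ 32 :> R by lra.
have h4 := le_trans h3 h2.
by rewrite -[_ / _]invf_div lef_pV2 ?posrE ?expR_gt0 in h4 => //; lra.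
Qed.

Lemma ln2_ge : 17 / 25 <= ln 2 :> R.
Proof.
rewrite -ler_expR lnK ?posrE//.
have h : 783 / 800 <= expR (- (17 / 800)) :> R.
  by have := expR_ge1Dx (- (17 / 800) : R); lra.
have h2 : (783 / 800) ^+ 32 <= expR (- (17 / 800)) ^+ 32 :> R.
  by apply: lerXn2r => //; rewrite nnegrE; [lra|exact: expR_ge0].
rewrite -expRM_natl mulrN expRN in h2.
have h3 : 2^-1 <= (783 / 800) ^+ 32 :> R by lra.
have h4 := le_trans h3 h2.
rewrite lef_pV2 ?posrE ?expR_gt0// in h4.
by rewrite (_ : 17 / 25 = 32%:R * (17 / 800))//; lra.
Qed.

Lemma ln2_le : ln 2 <= 18 / 25 :> R.
Proof.
rewrite -ler_expR lnK ?posrE//.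
have h : 209 / 200 <= expR (9 / 200) :> R.
  by have := expR_ge1Dx (9 / 200 : R); lra.
have h2 : (209 / 200) ^+ 16 <= expR (9 / 200) ^+ 16 :> R.
  by apply: lerXn2r => //; rewrite nnegrE; [lra|exact: expR_ge0].
rewrite -expRM_natl in h2.
rewrite (_ : 18 / 25 = 16%:R * (9 / 200)); last by lra.
by apply: le_trans h2; lra.
Qed.

Lemma atan_le x : 0 <= x -> atan x <= x.
Proof.
rewrite le_eqVlt => /predU1P[<-|x0]; first by rewrite atan0.
have [|c _] := @MVT _ (@atan R) (fun x => (1 + x ^+ 2)^-1) 0 x x0
  (fun y _ => is_derive1_atan y).
  by apply: continuous_subspaceT => y; exact: continuous_atan.
rewrite atan0 !subr0 => ->; rewrite ler_piMl ?(ltW x0)// invf_le1.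
  by rewrite lerDl sqr_ge0.
by rewrite ltr_pwDl// sqr_ge0.
Qed.

(* [pi / 4 = atan (1 / 2) + atan (1 / 3)]. *)
Lemma pi_le : pi <= 10 / 3 :> R.
Proof.
pose a : R := atan 2^-1; pose b : R := atan 3^-1.
have a0 : 0 <= a by rewrite -[leLHS]atan0 le_atan.
have b0 : 0 <= b by rewrite -[leLHS]atan0 le_atan.
have al : a <= 2^-1 by exact: atan_le.
have bl : b <= 3^-1 by exact: atan_le.
have pi2 := @pi_ge2 R.
have cpos (y : R) : 0 <= y -> y <= 5 / 6 -> 0 < cos y.
  by move=> y0 y1; apply: cos_gt0_pihalf; lra.
have ca : cos a != 0 by rewrite gt_eqF// cpos//; lra.
have cb : cos b != 0 by rewrite gt_eqF// cpos//; lra.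
have tab : tan (a + b) = 1.
  rewrite tanD//.
  by rewrite /a /b !atanK; field.
suff : a + b = pi / 4 by lra.
rewrite -atan1; apply: tan_inj; rewrite ?in_itv/=.
- by apply/andP; split; lra.
- by rewrite atan_gtNpi2 atan_ltpi2.
- by rewrite tab atanK.
Qed.

(* [2 * pi * expR 1] is about 17.1, and the minimum of the right-hand side about
   20.9, near [p = 4.6]; there is thus enough room to replace [2 `^ p] by a
   quadratic minorant around [p = 4] and [pi], [expR 1], [ln 2] by rationals. *)
Lemma powR2_ge p : 2 < p ->
  2 * pi * expR 1 <= 2 `^ p * ((p - 1)^-1 + 4 / (p - 2) ^+ 2) :> R.
Proof.
move=> p2; pose q := p - 2.
have q0 : 0 < q by rewrite subr_gt0.
have pie : 2 * pi * expR 1 <= 56 / 3 :> R.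
  have -> : 56 / 3 = (2 * (10 / 3)) * (14 / 5) :> R by lra.
  apply: ler_pM; rewrite ?expR_ge0 ?mulr_ge0 ?pi_ge0 ?expR1_le//.
  by rewrite ler_pM2l ?pi_le.
apply: (le_trans pie).
have -> : p - 1 = q + 1 by rewrite /q; lra.
rewrite -/q.
(* The tangent inequality is applied to the square root of 2^(p - 4); the square of the resulting
   affine minorant is the quadratic one. *)
have pE : 2 `^ p = 16 * (2 `^ ((q - 2) / 2)) ^+ 2 :> R.
  rewrite -powR_mulrn ?powR_ge0// -powRrM.
  rewrite (_ : p = 4%:R + (q - 2) / 2 * 2%:R); last by rewrite /q; lra.
  rewrite powRD; last by rewrite pnatr_eq0 implybT.
  by congr (_ * _); rewrite powR_mulrn//; lra.
set z : R := 2 `^ ((q - 2) / 2).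
have z0 : 0 <= z by exact: powR_ge0.
have zl : 1 + (q - 2) / 2 * ln 2 <= z.
  by rewrite /z /powR pnatr_eq0/= expR_ge1Dx.
have -> : q ^+ 2 = q * q by rewrite expr2.
have -> : (q + 1)^-1 + 4 / (q * q) = (q + 2) ^+ 2 / ((q + 1) * (q * q)).
  by field; rewrite gt_eqF//= gt_eqF//; lra.
rewrite pE -/z mulrA ler_pdivlMr; last by rewrite !mulr_gt0//; lra.
have l1 := ln2_ge; have l2 := ln2_le.
(* The lower bound on [ln 2] serves where [q - 2] is nonnegative, the upper one where it is
   negative. The slopes 17/50 and 9/25 are halves of these bounds. *)
have [qge|qlt] := leP 2 q.
- pose r := q - 2; have r0 : 0 <= r by rewrite subr_ge0.
  have zr : 1 + 17 / 50 * r <= z by apply: le_trans zl; rewrite /r; nra.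
  have {}zr : (1 + 17 / 50 * r) ^+ 2 <= z ^+ 2.
    by apply: lerXn2r => //; rewrite nnegrE; lra.
  apply: (@le_trans _ _ (16 * (1 + 17 / 50 * r) ^+ 2 * (q + 2) ^+ 2)).
    have -> : q = r + 2 by rewrite /r; lra.
    rewrite -subr_ge0.
    have r2 : 0 <= r ^+ 2 by exact: sqr_ge0.
    have r3 : 0 <= r ^+ 3 by exact: exprn_ge0.
    have r4 : 0 <= r ^+ 4 by exact: exprn_ge0.
    lra.
  by apply: ler_wpM2r; [exact: sqr_ge0|rewrite ler_pM2l//; lra].
- pose s := 2 - q; have s0 : 0 <= s by rewrite subr_ge0 ltW.
  have s2 : s <= 2 by rewrite /s; lra.
  have zr : 1 - 9 / 25 * s <= z by apply: le_trans zl; rewrite /s; nra.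
  have {}zr : (1 - 9 / 25 * s) ^+ 2 <= z ^+ 2.
    by apply: lerXn2r => //; rewrite nnegrE; lra.
  apply: (@le_trans _ _ (16 * (1 - 9 / 25 * s) ^+ 2 * (q + 2) ^+ 2)).
    have -> : q = 2 - s by rewrite /s; lra.
    rewrite -subr_ge0.
    nra.
  by apply: ler_wpM2r; [exact: sqr_ge0|rewrite ler_pM2l//; lra].
Qed.

(* The right-hand side is the integral of [y `^ (- q)] over [[x, x + h]]. *)
Lemma powR_step_le x h q : 0 < x -> 0 <= h -> 1 < q ->
  h * (x + h) `^ (- q) <= (x `^ (1 - q) - (x + h) `^ (1 - q)) / (q - 1).
Proof.
move=> x0 h0 q1; have xh0 : 0 < x + h by rewrite ltr_wpDr.
rewrite ler_pdivlMr ?subr_gt0//.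
have -> : (x + h) `^ (- q) = (x + h) `^ (1 - q) / (x + h).
  rewrite -[in X in _ / X](@powRr1 _ (x + h)) ?(ltW xh0)// -powRN -powRD.
    by congr (_ `^ _); lra.
  by rewrite (gt_eqF xh0) implybT.
have -> : x `^ (1 - q) = (x + h) `^ (1 - q) * (x / (x + h)) `^ (1 - q).
  rewrite -powRM ?(ltW xh0)// ?divr_ge0 ?(ltW x0) ?(ltW xh0)//.
  by rewrite mulrCA divff ?mulr1// gt_eqF.
set c := (x + h) `^ (1 - q); have c0 : 0 <= c by exact: powR_ge0.
set r := x / (x + h); have r0 : 0 < r by rewrite divr_gt0.
have -> : h * (c / (x + h)) * (q - 1) = c * ((q - 1) * (1 - r)).
  by rewrite /r; field; rewrite gt_eqF.
have -> : c * r `^ (1 - q) - c = c * (r `^ (1 - q) - 1) by ring.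
rewrite ler_wpM2l//.
(* What remains is (q - 1) (1 - r) <= r^(1 - q) - 1. It follows from ln r <= r - 1 and from 1 + u <=
   exp u at u = (1 - q) ln r. *)
have lr : ln r <= r - 1.
  have := expR_ge1Dx (ln r); rewrite lnK ?posrE//; lra.
rewrite /powR gt_eqF//; have := expR_ge1Dx ((1 - q) * ln r); nra.
Qed.

(** In the form x <= exp((x^2 - 1) / 2) this reduces, by 1 + u <= exp u, to (x - 1)^2 >= 0. Equality
    holds at x = 1. *)
Lemma mul_gauss_le x : 0 <= x -> x * expR (- (x ^+ 2 / 2)) <= expR (- 2^-1).
Proof.
move=> x0; rewrite expRN ler_pdivrMr ?expR_gt0// -expRD.
apply: le_trans (expR_ge1Dx _); have := sqr_ge0 (x - 1); nra.
Qed.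

End real_inequalities.

(** * Integration tools *)

Section decoupling.
Context d (T : measurableType d) (R : realType) (P : probability T R).
Variables (G1 G2 : set (set T)).
Hypothesis mG1 : G1 `<=` measurable.
Hypothesis mG2 : G2 `<=` measurable.
Hypothesis ind : forall A B : set T, <<s G1 >> A -> <<s G2 >> B ->
  P (A `&` B) = (P A * P B)%E.
Local Notation T1 := (g_sigma_algebraType G1).
Local Notation T2 := (g_sigma_algebraType G2).

Let sub_measurable (G : set (set T)) : G `<=` measurable ->
  <<s G >> `<=` measurable.
Proof. by move=> mG; apply: smallest_sub => //; exact: sigma_algebra_measurable. Qed.

(** The identity into [T] with a coarser sigma-algebra: the image of [P] under it is the restriction
    of [P] to that sigma-algebra. *)
Let i1 : T -> T1 := id.
Let i2 : T -> T2 := id.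

Let mi1 : measurable_fun setT i1.
Proof. by move=> _ A mA; rewrite setTI; exact: sub_measurable mA. Qed.

Let mi2 : measurable_fun setT i2.
Proof. by move=> _ A mA; rewrite setTI; exact: sub_measurable mA. Qed.

HB.instance Definition _ := @isMeasurableFun.Build _ _ T T1 i1 mi1.
HB.instance Definition _ := @isMeasurableFun.Build _ _ T T2 i2 mi2.

Let delta : T -> (T1 * T2)%type := fun w => (w, w).

Let mdelta : measurable_fun setT delta.
Proof. exact: (measurable_fun_pair mi1 mi2). Qed.

HB.instance Definition _ := @isMeasurableFun.Build _ _ T (T1 * T2)%type delta mdelta.

(* Independence says that the image of [P] under the diagonal map is the product
   of the restrictions of [P] to the two sub-sigma-algebras. *)
Lemma decoupling (f : T1 * T2 -> \bar R) :
  measurable_fun setT f -> (forall z, 0 <= f z)%E ->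
  (\int[P]_w f (w, w) = \int[P]_v \int[P]_w f (w, v))%E.
Proof.
move=> mf f0.
pose P1 : probability T1 R := distribution P i1.
pose P2 : probability T2 R := distribution P i2.
have PE X : measurable X -> (P1 \x P2)%E X = distribution P delta X.
  apply: product_measure_unique => A B mA mB.
  by rewrite /P1 /P2 /distribution/= /pushforward/=; exact: ind.
transitivity (\int[distribution P delta]_z f z)%E.
  by rewrite ge0_integral_pushforward.
transitivity (\int[P1 \x P2]_z f z)%E.
  by apply: eq_measure_integral => A mA _; exact/esym/PE.
rewrite fubini_tonelli2// ge0_integral_pushforward//; last 2 first.
- exact: measurable_fun_fubini_tonelli_G.
- by move=> x _; exact: integral_ge0.
apply: eq_integral => v _ /=; rewrite /fubini_G ge0_integral_pushforward//.
by apply: measurableT_comp => //; exact: measurable_pair2.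
Qed.

End decoupling.

Section density.
Context d (T : measurableType d) (R : realType).
Variables (mu nu : {measure set T -> \bar R}) (g : T -> R).
Hypothesis mg : measurable_fun setT g.
Hypothesis g0 : forall x, 0 <= g x.
Hypothesis nuE : forall A, measurable A ->
  nu A = (\int[mu]_(x in A) (g x)%:E)%E.
Local Open Scope ereal_scope.
Import HBNNSimple.

(** For indicators this is [nuE]; linearity gives it for the simple functions [h n], and monotone
    convergence on both sides gives it for [f]. It serves for the normal and the exponential
    laws. *)
Lemma ge0_integral_density (f : T -> \bar R) :
  measurable_fun setT f -> (forall x, 0 <= f x) ->
  \int[nu]_x f x = \int[mu]_x (f x * (g x)%:E).
Proof.
move=> mf f0.
have mEg : measurable_fun setT (EFin \o g) by exact/measurable_EFinP.
have g0' x : 0 <= (g x)%:E by rewrite lee_fin.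
pose h := nnsfun_approx measurableT mf.
have hf x : (h n x)%:E @[n --> \oo] --> f x by exact: cvg_nnsfun_approx.
have ndh x : nondecreasing_seq (fun n => (h n x)%:E).
  by move=> m n mn; rewrite lee_fin; exact/lefP/nd_nnsfun_approx.
have indicE (A : set T) : measurable A ->
    \int[mu]_x ((\1_A x)%:E * (g x)%:E) = nu A.
  move=> mA; rewrite nuE// [RHS]integral_mkcond; apply: eq_integral => x _.
  by rewrite patchE indicE; case: ifP; rewrite ?mul1e ?mul0e.
have mh m r : measurable_fun setT (fun x => (r * \1_(h m @^-1` [set r]) x)%:E).
  by apply/measurable_EFinP; exact: measurable_funM.
have simple n : \int[mu]_x ((h n x)%:E * (g x)%:E) = \int[nu]_x (h n x)%:E.
  transitivity (\int[mu]_x (\sum_(r \in range (h n))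
      ((r * \1_(h n @^-1` [set r]) x)%:E * (g x)%:E))).
    apply: eq_integral => x _; rewrite fimfunE -fsumEFin//.
    by rewrite ge0_mule_fsuml// => r; exact: nnfun_muleindic_ge0.
  rewrite ge0_integral_fsum//; last 2 first.
  - by move=> r; exact: emeasurable_funM.
  - by move=> r x _; rewrite mule_ge0 ?nnfun_muleindic_ge0.
  transitivity (\int[nu]_x (\sum_(r \in range (h n))
      (r * \1_(h n @^-1` [set r]) x)%:E)); last first.
    by apply: eq_integral => x _; rewrite fimfunE -fsumEFin.
  rewrite ge0_integral_fsum//; last by move=> r x _; exact: nnfun_muleindic_ge0.
  apply: eq_fsbigr => r /set_mem[t _ <-].
  under eq_integral do rewrite EFinM -muleA.
  under [RHS]eq_integral do rewrite EFinM.
  rewrite !ge0_integralZl//; try by rewrite lee_fin.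
  + by rewrite indicE// integral_indic// setIT.
  + by apply: emeasurable_funM => //; exact/measurable_EFinP.
  + by move=> x _; rewrite mule_ge0// lee_fin.
  + exact/measurable_EFinP.
transitivity (limn (fun n => \int[nu]_x (h n x)%:E)).
  rewrite -monotone_convergence//.
  - by apply: eq_integral => x _; exact/esym/cvg_lim.
  - by move=> n; exact/measurable_EFinP.
  - by move=> n x _; rewrite lee_fin.
under eq_fun do rewrite -simple.
rewrite -monotone_convergence//.
- apply: eq_integral => x _; apply/cvg_lim => //.
  by apply: cvgeZr => //; exact: hf.
- by move=> n; apply: emeasurable_funM => //; exact/measurable_EFinP.
- by move=> n x _; rewrite mule_ge0// lee_fin.
- by move=> x _ m n mn; rewrite lee_wpmul2r//; exact: ndh.
Qed.

End density.

Section lebesgue_affine.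
Context {R : realType}.
Local Notation mu := (@lebesgue_measure R).
Variables (a b : R).
Hypothesis a0 : 0 < a.

Let phi : measurableTypeR R -> measurableTypeR R := fun x => a * x + b.

Let mphi : measurable_fun setT phi.
Proof. by apply: measurable_funD => //; exact: measurable_funM. Qed.

Let push : {measure set (measurableTypeR R) -> \bar R}.
Proof. by refine (pushforward mu phi). Defined.

(** The left-hand side is a measure that agrees with [mu] on half-open intervals, and these
    determine Lebesgue measure. *)
Lemma lebesgue_measure_affine (A : set R) : measurable A ->
  (a%:E * mu [set x | A (a * x + b)%R] = mu A)%E.
Proof.
move=> mA; apply/esym.
have an : 0 <= a by exact: ltW.
pose nu := mscale (NngNum an) push.
have nuE B : nu B = (a%:E * mu [set x | B (a * x + b)%R])%E by [].
rewrite -nuE; apply: lebesgue_measure_unique => // _ [[u v]] _ <-.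
apply: (etrans _ (esym (nuE _))).
rewrite (_ : [set x | `]u, v]%classic (a * x + b)] =
    `](u - b) / a, (v - b) / a]%classic); last first.
  apply/seteqP; split => x /=; rewrite !in_itv/=;
    by rewrite ltr_pdivrMr// ler_pdivlMr// ltrBlDr lerBrDr mulrC.
rewrite !lebesgue_measure_itv/= !lte_fin ltr_pM2r ?invr_gt0// ltrD2r.
case: ifPn => _; last by rewrite mule0.
by rewrite -!EFinB -EFinM; congr EFin; field; rewrite gt_eqF.
Qed.

Lemma ge0_integral_affine (f : R -> \bar R) :
  measurable_fun setT f -> (forall x, 0 <= f x)%E ->
  (a%:E * \int[mu]_x f (a * x + b)%R = \int[mu]_x f x)%E.
Proof.
move=> mf f0; have an : 0 <= a by exact: ltW.
transitivity (\int[mscale (NngNum an) push]_x f x)%E.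
  by rewrite ge0_integral_mscale// ge0_integral_pushforward.
by apply: eq_measure_integral => A mA _; rewrite [LHS]lebesgue_measure_affine.
Qed.

End lebesgue_affine.

(** * Gaussian sums *)

Section gaussian_convolution.
Context {R : realType}.
Variable sigma : R.
Hypothesis sigma0 : 0 < sigma.
Local Notation mu := (@lebesgue_measure R).
Local Notation N := (normal_prob 0 sigma).
Local Notation phi := (normal_pdf 0 sigma).

(* For independent [x] and [z] of density [phi], the law of [v = s * x + t * z] times
   the conditional law of [x] given [v]. *)
Lemma normal_pdf_rotation (s t v x : R) : 0 < s -> 0 < t ->
  let u := Num.sqrt (s ^+ 2 + t ^+ 2) in
  t^-1 * (phi x * phi (t^-1 * v - s * x / t)) =
  u^-1 * phi (u^-1 * v) * normal_pdf (s * v / u ^+ 2) (sigma * t / u) x.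
Proof.
move=> s0 t0 u.
have u2 : u ^+ 2 = s ^+ 2 + t ^+ 2 by rewrite sqr_sqrtr// addr_ge0// sqr_ge0.
have u0 : 0 < u by rewrite sqrtr_gt0 addr_gt0// exprn_gt0.
have sn : sigma != 0 by rewrite gt_eqF.
have rn : sigma * t / u != 0 by rewrite gt_eqF// divr_gt0// mulr_gt0.
rewrite /normal_pdf (negbTE sn) (negbTE rn) /normal_peak /normal_fun.
have peakE : (Num.sqrt ((sigma * t / u) ^+ 2 * pi *+ 2))^-1 =
    u / t * (Num.sqrt (sigma ^+ 2 * pi *+ 2))^-1.
  rewrite (_ : (sigma * t / u) ^+ 2 * pi *+ 2 =
    (t / u) ^+ 2 * (sigma ^+ 2 * pi *+ 2)); last by field; rewrite gt_eqF.
  rewrite sqrtrM ?sqr_ge0// sqrtr_sqr ger0_norm ?divr_ge0 ?(ltW t0) ?(ltW u0)//.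
  by rewrite invfM invf_div.
rewrite peakE; set k := (Num.sqrt _)^-1.
set a := expR _; set b := expR _; set c := expR _; set e := expR _.
suff ab : a * b = c * e.
  transitivity (t^-1 * k * k * (a * b)); first by ring.
  by rewrite ab; field; rewrite !gt_eqF.
rewrite /a /b /c /e -!expRD; congr expR.
have eqn y z : - (y ^+ 2) / z = - (y ^+ 2 / z) by rewrite mulNr.
rewrite !eqn -!opprD; congr (- _).
rewrite (_ : (sigma * t / u) ^+ 2 *+ 2 =
  (sigma ^+ 2 *+ 2) * (t ^+ 2 / u ^+ 2)); last by field; rewrite gt_eqF.
rewrite -[sigma ^+ 2 *+ 2]mulr_natr.
have un : u != 0 by rewrite gt_eqF.
have tn : t != 0 by rewrite gt_eqF.
(* Completing the square in [x]. For [field], [u] is a free variable, so the relation between [u],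
   [s] and [t] enters only through the rewritings with [u2]. *)
have -> : (x - 0) ^+ 2 / (sigma ^+ 2 * 2) +
     (t^-1 * v - s * x / t - 0) ^+ 2 / (sigma ^+ 2 * 2) =
  ((s ^+ 2 + t ^+ 2) * x ^+ 2 - 2 * s * x * v + v ^+ 2) / t ^+ 2 / (sigma ^+ 2 * 2).
  by field; rewrite sn tn.
rewrite -u2.
have -> : (u^-1 * v - 0) ^+ 2 / (sigma ^+ 2 * 2) +
   (x - s * v / u ^+ 2) ^+ 2 / (sigma ^+ 2 * 2 * (t ^+ 2 / u ^+ 2)) =
  ((u ^+ 2) * x ^+ 2 - 2 * s * x * v + v ^+ 2 * (s ^+ 2 + t ^+ 2) / u ^+ 2) / t ^+ 2 / (sigma ^+ 2 * 2).
  by field; rewrite sn tn un.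
by rewrite -u2 mulfK// expf_neq0.
Qed.

Let mphi : measurable_fun setT phi.
Proof. exact: measurable_normal_pdf. Qed.

Lemma normal_probE (A : set R) : measurable A ->
  N A = (\int[mu]_x (\1_A x * phi x)%:E)%E.
Proof.
move=> mA; rewrite /normal_prob integral_mkcond; apply: eq_integral => x _.
by rewrite patchE indicE; case: ifP; rewrite ?mul1r ?mul0r.
Qed.

Lemma ge0_integral_normal_prob (f : R -> \bar R) :
  measurable_fun setT f -> (forall x, 0 <= f x)%E ->
  (\int[N]_x f x = \int[mu]_x (f x * (phi x)%:E))%E.
Proof.
move=> mf f0; apply: (@ge0_integral_density _ _ _ mu N phi mphi) => //.
by move=> x; exact: normal_pdf_ge0.
Qed.

Lemma measurable_affine_preimage (a b : R) (B : set R) : measurable B ->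
  measurable [set x | B (a * x + b)].
Proof.
move=> mB; rewrite -[X in measurable X]setTI.
suff : measurable_fun setT (fun x => a * x + b) by exact.
by apply: measurable_funD => //; exact: measurable_funM.
Qed.

(** The substitution [v = s * x + t * z] for [z] and [normal_pdf_rotation] separate a density in [v]
    from a conditional density in [x], whose integral is 1. The degenerate cases are treated apart
    because they do occur: [s = 0] for an empty sum and [t = 0] for a weight that the truncation
    cancels. *)
Lemma normal_convolution (s t : R) (B : set R) : 0 <= s -> 0 <= t ->
  measurable B ->
  (\int[N]_z N [set x | B (s * x + t * z)%R])%E =
  N [set x | B (Num.sqrt (s ^+ 2 + t ^+ 2) * x)].
Proof.
move=> s0 t0 mB.
have mpre a : measurable [set x | B (a * x)].
  by have := measurable_affine_preimage a 0 mB; under eq_set do rewrite addr0.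
move: s0; rewrite le_eqVlt => /predU1P[<-|s0].
  rewrite expr0n/= add0r sqrtr_sqr ger0_norm//.
  transitivity (\int[N]_z (\1_[set x | B (t * x)] z)%:E)%E; last first.
    by rewrite integral_indic// ?setIT//; exact: mpre.
  apply: eq_integral => z _; rewrite indicE.
  have [/set_mem/= Bz|Bz] := boolP (z \in _).
    rewrite (_ : [set _ | _] = setT) ?probability_setT//.
    by apply/seteqP; split => // x _ /=; rewrite mul0r add0r.
  rewrite (_ : [set _ | _] = set0) ?measure0//.
  apply/seteqP; split => // x /=; rewrite mul0r add0r => Bx.
  by move/negP: Bz; apply; exact/mem_set.
move: t0; rewrite le_eqVlt => /predU1P[<-|t0].
  rewrite expr0n/= addr0 sqrtr_sqr gtr0_norm//.
  under eq_integral do under eq_set do rewrite mul0r addr0.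
  by move: (N _) => k; rewrite integral_cst// -[RHS]mule1; congr (_ * _)%E; exact: probability_setT.
set u := Num.sqrt _.
have u0 : 0 < u by rewrite sqrtr_gt0 addr_gt0// exprn_gt0.
have mind : measurable_fun setT (fun p : R * R => \1_B (s * p.1 + t * p.2) : R).
  apply: measurableT_comp; first exact: measurable_indic.
  by apply: measurable_funD; apply: measurable_funM.
have m1 : measurable_fun setT (fun p : R * R => phi p.1).
  exact: (measurableT_comp mphi).
have m2 : measurable_fun setT (fun p : R * R => phi p.2).
  exact: (measurableT_comp mphi).
have p0 : forall x, 0 <= phi x by move=> x; exact: normal_pdf_ge0.
have i0 : forall x, 0 <= \1_B x :> R by [].
pose F (p : R * R) : \bar R := (\1_B (s * p.1 + t * p.2) * phi p.1 * phi p.2)%:E.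
have mF : measurable_fun setT F.
  by apply/measurable_EFinP; do 2 apply: measurable_funM => //.
have mFx x (g : R -> R) : measurable_fun setT g ->
    measurable_fun setT (fun v : R => F (x, g v)).
  by move=> mg; apply: (measurableT_comp mF); exact: measurable_fun_pair.
have F0 p : (0 <= F p)%E by rewrite lee_fin !mulr_ge0.
(* [H] is [F] after the substitution, with the Jacobian [t^-1] included. *)
pose H (p : R * R) : \bar R := (\1_B p.2 * (u^-1 * phi (u^-1 * p.2) *
  normal_pdf (s * p.2 / u ^+ 2) (sigma * t / u) p.1))%:E.
have HE x v : ((t^-1)%:E * F (x, (t^-1 * v - s * x / t)%R) = H (x, v))%E.
  rewrite /H /F/= -normal_pdf_rotation// -EFinM; congr EFin.
  rewrite (_ : s * x + t * (t^-1 * v - s * x / t) = v); last first.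
    by field; rewrite gt_eqF.
  by ring.
have H0 p : (0 <= H p)%E by rewrite lee_fin !mulr_ge0 ?invr_ge0 ?(ltW u0)// normal_pdf_ge0.
have mH : measurable_fun setT H.
  rewrite (_ : H = (fun p => (t^-1)%:E * F (p.1, (t^-1 * p.2 - s * p.1 / t)%R))%E).
    apply: emeasurable_funM => //; apply: (measurableT_comp mF).
    apply: measurable_fun_pair => //; apply: measurable_funB.
      exact: measurable_funM.
    by apply: measurable_funM => //; exact: measurable_funM.
  by apply/funext => -[x v]; rewrite HE.
transitivity (\int[mu]_z \int[mu]_x F (x, z))%E.
  rewrite ge0_integral_normal_prob//=; last first.
    apply: (@eq_measurable_fun _ _ _ _ _ (fun z => \int[mu]_x (\1_B (s * x + t * z)%R * phi x)%:E)%E).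
      move=> z _; rewrite -normal_probE//.
      exact: measurable_affine_preimage.
    apply: (@measurable_fun_fubini_tonelli_G _ _ _ _ _ mu (fun p => (\1_B (s * p.1 + t * p.2) * phi p.1)%:E)).
      by apply/measurable_EFinP; apply: measurable_funM.
    by move=> p; rewrite lee_fin mulr_ge0.
  apply: eq_integral => z _; rewrite normal_probE; last first.
    exact: measurable_affine_preimage.
  rewrite -ge0_integralZr//.
  - apply/measurable_EFinP; apply: measurable_funM => //.
    apply: measurable_indic; exact: measurable_affine_preimage.
  - by move=> x _; rewrite lee_fin mulr_ge0.
  - by rewrite lee_fin.
rewrite -fubini_tonelli//.
transitivity (\int[mu]_x \int[mu]_v H (x, v))%E.
  apply: eq_integral => x _.
  rewrite -[LHS](@ge0_integral_affine _ t^-1 (- (s * x / t)))//=; last 2 first.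
  - by rewrite invr_gt0.
  - exact: (mFx x id).
  rewrite -ge0_integralZl; [|exact: measurableT| |by []|].
  - by apply: eq_integral => v _; rewrite HE.
  - apply: (mFx x (fun v => t^-1 * v - s * x / t)).
    by apply: measurable_funD => //; exact: measurable_funM.
  - by rewrite lee_fin invr_ge0 ltW.
rewrite fubini_tonelli//.
transitivity (\int[mu]_v (u^-1%:E * (\1_[set x | B (u * x)] (u^-1 * v) * phi (u^-1 * v))%:E))%E.
  apply: eq_integral => v _; rewrite /H/=.
  under eq_integral do rewrite mulrA EFinM.
  rewrite ge0_integralZl//=.
  - rewrite integral_normal_pdf mule1 -EFinM; congr EFin.
    have -> : \1_[set x | B (u * x)] (u^-1 * v) = \1_B v :> R.
      rewrite !indicE; congr ((_ : bool)%:R); apply: asbool_equiv_eq => /=.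
      by rewrite mulVKf// gt_eqF.
    by ring.
  - by apply/measurable_EFinP; exact: measurable_normal_pdf.
  - by move=> x _; rewrite lee_fin normal_pdf_ge0.
  - by rewrite lee_fin !mulr_ge0// invr_ge0 ltW.
set A := [set x | B (u * x)].
have mA : measurable_fun setT (fun x : R => (\1_A x * phi x)%:E).
  apply/measurable_EFinP; apply: measurable_funM => //.
  by apply: measurable_indic; exact: mpre.
have mAu : measurable_fun setT (fun x : R => (\1_A (u^-1 * x) * phi (u^-1 * x))%:E).
  by apply: (measurableT_comp mA); exact: measurable_funM.
rewrite normal_probE; last exact: mpre.
rewrite -[RHS](@ge0_integral_affine _ u^-1 0)//; last 2 first.
- by rewrite invr_gt0.
- by move=> x; rewrite lee_fin mulr_ge0.
under [in RHS]eq_integral do rewrite addr0.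
rewrite -ge0_integralZl; [by []|exact: measurableT|exact: mAu|..].
- by move=> v _; rewrite lee_fin mulr_ge0.
- by rewrite lee_fin invr_ge0 ltW.
Qed.

End gaussian_convolution.

Section gaussian_sums.
Context d (T : measurableType d) (R : realType) (P : probability T R).
Variables (sigma : R) (W : nat -> {RV P >-> R}).
Hypothesis sigma0 : 0 < sigma.
Hypothesis W_normal : forall (j : nat) (A : set R), measurable A ->
  distribution P (W j) A = normal_prob 0 sigma A.
Hypothesis W_independent : independent_RVs W.
Local Notation N := (normal_prob 0 sigma).

(** A pi-system that generates the sigma-algebra of the first [n] variables; the hypothesis of
    independence gives product formulas for such events directly. *)
Let cylinder (n : nat) : set (set T) :=
  [set E | exists A : nat -> set R, (forall i, measurable (A i)) /\
     E = \bigcap_(i in `I_n) (W i @^-1` A i)].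

Let measurable_pre j (A : set R) : measurable A -> measurable (W j @^-1` A).
Proof. by move=> mA; exact: measurable_funPTI. Qed.

Let measurable_cylinder n : cylinder n `<=` measurable.
Proof.
move=> _ [A [mA ->]]; apply: bigcap_measurableType => i _.
exact: measurable_pre.
Qed.

(** The product formula is used for the first [n + 1] indices and again for the first [n], with [A']
    equal to [A] below [n] and to [B] at [n]; the quotient of the two is the factor of index [n]. *)
Let cylinder_independent n E B : cylinder n E -> measurable B ->
  P (E `&` W n @^-1` B) = (P E * P (W n @^-1` B))%E.
Proof.
move=> [A [mA ->]] mB.
pose A' i := if i == n then B else A i.
have mA' i : measurable (A' i) by rewrite /A'; case: ifP.
have A'E i : (i < n)%N -> A' i = A i by move=> lin; rewrite /A' ltn_eqF.
pose J k : {fset nat} := [fset i in iota 0 k]%fset.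
have memJ k i : (i \in J k) = (i < k)%N by rewrite !inE mem_iota.
have JE k : [set` J k] = `I_k.
  apply/seteqP; split => i /=; by rewrite memJ.
have ind := @W_independent A' mA'.
have := ind (J n.+1); rewrite JE.
have -> : J n.+1 = (n |` J n)%fset.
  by apply/fsetP => i; rewrite in_fset1U !memJ ltnS leq_eqVlt.
rewrite big_fsetU1/=; last by rewrite memJ ltnn.
rewrite EFinM -(ind (J n)) JE fineK ?fin_num_measure//; last exact: measurable_pre.
have -> : \bigcap_(i in `I_n.+1) (W i @^-1` A' i) =
    \bigcap_(i in `I_n) (W i @^-1` A i) `&` W n @^-1` B.
  apply/seteqP; split => w.
    move=> h; split=> [i /= lin|]; first by rewrite -A'E//; apply: h => /=; exact: ltnW.
    by have := h n (ltnSn _); rewrite /A' eqxx.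
  move=> [h hB] i /=; rewrite ltnS leq_eqVlt => /predU1P[->|lin].
    by rewrite /A' eqxx.
  by rewrite A'E//; exact: h.
have -> : A' n = B by rewrite /A' eqxx.
rewrite muleC => ->; congr (P _ * _)%E.
by apply: eq_bigcapr => i lin; rewrite A'E.
Qed.

Let cylinderI n : setI_closed (cylinder n).
Proof.
move=> _ _ [A [mA ->]] [B [mB ->]]; exists (fun i => A i `&` B i); split.
  by move=> i; exact: measurableI.
by rewrite -bigcapI; apply: eq_bigcapr => i _; rewrite preimage_setI.
Qed.

(** Dynkin's argument: for fixed [B], the events that satisfy the product formula form a
    lambda-system containing the pi-system of cylinders. *)
Let cylinder_sigma_independent n E B : <<s cylinder n >> E -> measurable B ->
  P (E `&` W n @^-1` B) = (P E * P (W n @^-1` B))%E.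
Proof.
move=> sE mB; pose F := W n @^-1` B.
have mF : measurable F by exact: measurable_pre.
pose H := [set E | measurable E /\ P (E `&` F) = (P E * P F)%E].
suff : <<s cylinder n >> `<=` H by move=> /(_ _ sE)[].
have finP (A : set T) : measurable A -> P A \is a fin_num by exact: fin_num_measure.
apply: (@lambda_system_subset _ _ (@cylinderI n) setT H) => //.
- split => //.
  + by split => //; rewrite setTI probability_setT mul1e.
  + move=> A C CA [mA hA] [mC hC]; split; first exact: measurableD.
    have mAF := measurableI _ _ mA mF; have mCF := measurableI _ _ mC mF.
    rewrite (_ : (A `\` C) `&` F = (A `&` F) `\` (C `&` F)); last first.
      by apply/seteqP; split => [x [[Ax nC] Fx]|x [[Ax Fx] nC]]; split => //;
        [case|split => // Cx; apply: nC].
    rewrite measureD//; last by rewrite ltey_eq finP.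
    rewrite measureD//; last by rewrite ltey_eq finP.
    rewrite (_ : A `&` F `&` (C `&` F) = C `&` F); last first.
      by rewrite -setIIl (setIidr CA).
    rewrite (_ : A `&` C = C); last by rewrite setIidr.
    transitivity (P A * P F - P C * P F)%E; first by congr (_ - _)%E.
    by rewrite muleBl ?finP// fin_num_adde_defr// finP.
  + move=> A ndA hA.
    have mA i : measurable (A i) by have [] := hA i.
    split; first exact: bigcup_measurable.
    rewrite setI_bigcupl.
    have h1 : P (A i) @[i --> \oo] --> P (\bigcup_i A i).
      by apply: nondecreasing_cvg_mu => //; exact: bigcup_measurable.
    have h2 : P (A i `&` F) @[i --> \oo] --> P (\bigcup_i (A i `&` F)).
      apply: nondecreasing_cvg_mu => //.
      - by move=> i; exact: measurableI.
      - by apply: bigcup_measurable => i _; exact: measurableI.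
      - by move=> i j ij; apply/subsetPset; apply: setSI; apply/subsetPset; exact: ndA.
    have h3 : P (A i `&` F) @[i --> \oo] --> (P (\bigcup_i A i) * P F)%E.
      rewrite (_ : (fun i => P (A i `&` F)) = (fun i => P (A i) * P F)%E); last first.
        by apply/funext => i; have [] := hA i.
      by apply: cvgeZr => //; exact: finP.
    by rewrite -(cvg_lim _ h2)// (cvg_lim _ h3).
- move=> E' cE; split; first exact: measurable_cylinder cE.
  exact: cylinder_independent.
Qed.

(** Induction on [n]: with the value of [W n] frozen by [decoupling], the first [n] terms follow the
    induction hypothesis for a translate of [B], and [normal_convolution] absorbs the last term. *)
Lemma gaussian_sum_law (a : nat -> R) n (B : set R) :
  (forall j, 0 <= a j) -> measurable B ->
  P [set w | B (\sum_(j < n) W j w * a j)] =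
  N [set x | B (Num.sqrt (\sum_(j < n) a j ^+ 2) * x)].
Proof.
move=> a0; elim: n B => [|n IH] B mB.
  rewrite big_ord0 sqrtr0.
  have [B0|B0] := pselect (B 0).
    rewrite (_ : [set w | _] = setT); last first.
      by apply/seteqP; split => // w _ /=; rewrite big_ord0.
    rewrite (_ : [set x | _] = setT); last first.
      by apply/seteqP; split => // w _ /=; rewrite mul0r.
    by rewrite !probability_setT.
  rewrite (_ : [set w | _] = set0); last first.
    by apply/seteqP; split => // w /=; rewrite big_ord0.
  rewrite (_ : [set x | _] = set0); last first.
    by apply/seteqP; split => // w /=; rewrite mul0r.
  by rewrite !measure0.
pose G2 := preimage_set_system setT (W n) measurable.
(* The preimages under [W n] already form a sigma-algebra, so generating from them adds no set. *)
have G2E F : <<s G2 >> F -> exists2 B, measurable B & F = W n @^-1` B.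
  have sG2 : sigma_algebra setT G2.
    exact: sigma_algebra_preimage (sigma_algebra_measurable _).
  rewrite (sigma_algebra_id sG2) => -[C mC <-]; exists C => //.
  by rewrite setTI.
have mG2 : G2 `<=` measurable.
  by move=> _ [C mC <-]; rewrite setTI; exact: measurable_pre.
have dec := @decoupling _ T R P (cylinder n) G2 (@measurable_cylinder n) mG2.
have {}dec := dec (fun E F sE sF =>
  let: ex_intro2 C mC FE := G2E F sF in
  eq_ind_r (fun F => P (E `&` F) = (P E * P F)%E)
    (cylinder_sigma_independent sE mC) FE).
pose S (w : g_sigma_algebraType (cylinder n)) := \sum_(j < n) W j w * a j.
have mS : measurable_fun setT S.
  apply: measurable_sum => j; apply: measurable_funM => //.
  move=> _ C mC; rewrite setTI; apply: sub_gen_smallest.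
  exists (fun i : nat => if i == j :> nat then C else setT); split.
    by move=> i; case: ifP.
  apply/seteqP; split => w /=.
    by move=> Cw i _ /=; case: eqP => // ->.
  by move=> /(_ j (ltn_ord j)) /=; rewrite eqxx.
have mW : measurable_fun setT (W n : g_sigma_algebraType G2 -> R).
  by move=> _ C mC; rewrite setTI; apply: sub_gen_smallest; exists C => //; rewrite setTI.
pose f (z : g_sigma_algebraType (cylinder n) * g_sigma_algebraType G2) : \bar R :=
  (\1_B (S z.1 + W n z.2 * a n))%:E.
have mf : measurable_fun setT f.
  apply/measurable_EFinP; apply: measurableT_comp; first exact: measurable_indic.
  apply: measurable_funD; first exact: (measurableT_comp mS).
  by apply: measurable_funM => //; exact: (measurableT_comp mW).
have f0 z : (0 <= f z)%E by rewrite lee_fin.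
have mSn : measurable_fun setT (fun w : T => \sum_(j < n.+1) W j w * a j).
  by apply: measurable_sum => j; exact: measurable_funM.
have mSn' : measurable_fun setT (fun w : T => \sum_(j < n) W j w * a j).
  by apply: measurable_sum => j; exact: measurable_funM.
transitivity (\int[P]_w f (w, w))%E.
  rewrite -[in LHS](setIT [set w | _]) -integral_indic//; last first.
    by rewrite -[X in measurable X]setTI; exact: mSn.
  apply: eq_integral => w _; rewrite /f/= !indicE; congr ((_ : bool)%:R%:E).
  by apply: asbool_equiv_eq => /=; rewrite big_ord_recr.
rewrite dec//.
set s := Num.sqrt (\sum_(j < n) a j ^+ 2).
transitivity (\int[P]_v N [set x | B (s * x + a n * W n v)%R])%E.
  apply: eq_integral => v _.
  have mB' : measurable [set y | B (y + W n v * a n)].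
    have := measurable_affine_preimage 1 (W n v * a n) mB.
    by under eq_set do rewrite mul1r.
  under eq_set do rewrite (mulrC (a n)).
  rewrite -[RHS](IH _ mB').
  rewrite -[in RHS](setIT [set w | _]) -integral_indic//.
  by rewrite -[X in measurable X]setTI; exact: mSn'.
rewrite big_ord_recr/= -[X in X + a n ^+ 2](@sqr_sqrtr _ (\sum_(j < n) a j ^+ 2)); last first.
  by apply: sumr_ge0 => j _; exact: sqr_ge0.
 rewrite -/s -normal_convolution// ?sqrtr_ge0//.
have mN : measurable_fun setT (fun z : R => N [set x | B (s * x + a n * z)%R]).
  rewrite (_ : (fun z => _) = (fun z => \int[N]_x (\1_B (s * x + a n * z))%:E)%E).
    apply: (@measurable_fun_fubini_tonelli_G _ _ _ _ _ N
      (fun p : R * R => (\1_B (s * p.1 + a n * p.2))%:E)) => //.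
    apply/measurable_EFinP; apply: measurableT_comp; first exact: measurable_indic.
    by apply: measurable_funD; apply: measurable_funM.
  apply/funext => z.
  rewrite -[X in N X](setIT [set x | _]) -integral_indic//.
  exact: measurable_affine_preimage.
have mWn : measurable_fun setT (W n : T -> measurableTypeR R).
  by move=> _ C mC; rewrite setTI; exact: measurable_pre.
transitivity (\int[pushforward P (W n : T -> measurableTypeR R)]_z
    N [set x | B (s * x + a n * z)%R])%E.
  by rewrite ge0_integral_pushforward.
by apply: eq_measure_integral => A mA _; exact: W_normal.
Qed.

End gaussian_sums.

(** * Comparison of distribution functions *)

Section convergence_in_law.
Context d (T : measurableType d) (R : realType) (P : probability T R).

Let measurable_gt_norm (S S' : T -> R) (e : R) : measurable_fun setT S ->
  measurable_fun setT S' -> measurable [set w | e < `|S w - S' w|].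
Proof.
move=> mS mS'; rewrite -[X in measurable X]setTI.
have mD : measurable_fun setT (fun w => `|S w - S' w|).
  by apply: measurableT_comp => //; exact: measurable_funB.
have := mD measurableT `]e, +oo[%classic (measurable_itv _).
rewrite (_ : _ @^-1` _ = [set w | e < `|S w - S' w|])//.
by apply/seteqP; split => w /=; rewrite in_itv/= andbT.
Qed.

(** Dominated convergence: for almost every [w] the indicators of these events are eventually 0. *)
Lemma ae_cvg_in_probability (Sn : nat -> T -> R) (S : T -> R) (e : R) :
  (forall n, measurable_fun setT (Sn n)) -> measurable_fun setT S ->
  {ae P, forall w, Sn n w @[n --> \oo] --> S w} -> 0 < e ->
  P [set w | e < `|Sn n w - S w|] @[n --> \oo] --> 0%E.
Proof.
move=> mSn mS cS e0.
pose A n := [set w | e < `|Sn n w - S w|].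
have mA n : measurable (A n) by exact: measurable_gt_norm.
have mf n : measurable_fun setT (fun w => (\1_(A n) w)%:E : \bar R).
  by apply/measurable_EFinP; exact: measurable_indic.
have ig : P.-integrable setT (cst 1%E) by exact: finite_measure_integrable_cst.
have h1 : {ae P, forall w, setT w -> (\1_(A n) w)%:E @[n --> \oo] --> (0%E : \bar R)}.
  apply: filterS cS => w cw _; apply: cvg_near_cst.
  have /cvgrPdist_lt /(_ e e0) := cw; apply: filterS => n; rewrite distrC => h.
  rewrite indicE memNset// /A/= => h'.
  by have := lt_trans h h'; rewrite ltxx.
have h2 : {ae P, forall w n, setT w -> (`|(\1_(A n) w)%:E| <= (cst 1%E w : \bar R))%E}.
  apply: aeW => w n _; rewrite indicE.
  by case: (_ \in _); rewrite /= ?normr0 ?normr1 ?lee_fin.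
have [_ _] := dominated_convergence measurableT mf
  (@measurable_cst _ _ _ _ setT 0%E) h1 ig h2.
rewrite integral0 => h.
have -> : (fun n => P [set w | e < `|Sn n w - S w|]) =
    (fun n => \int[P]_w (\1_(A n) w)%:E)%E.
  by apply/funext => n; rewrite integral_indic// setIT.
exact: h.
Qed.

(* Convergence in probability gives the bound up to a shift of the argument, which
   right continuity of the distribution functions then removes. *)
Lemma cdf_le_ae_limit (Sn Tn : nat -> T -> R) (S : T -> R) (Y : {RV P >-> R})
    (b : R) :
  (forall n, measurable_fun setT (Sn n)) -> (forall n, measurable_fun setT (Tn n)) ->
  measurable_fun setT S ->
  {ae P, forall w, Sn n w @[n --> \oo] --> S w} ->
  {ae P, forall w, Tn n w @[n --> \oo] --> Y w} ->
  (\forall n \near \oo, forall y,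
    P [set w | (Sn n w <= y)%R] <= P [set w | (Tn n w <= y)%R] + b%:E)%E ->
  forall x, (P [set w | (S w <= x)%R] <= P [set w | (Y w <= x)%R] + b%:E)%E.
Proof.
move=> mSn mTn mS cS cT le_b x.
have mle (f : T -> R) y : measurable_fun setT f -> measurable [set w | (f w <= y)%R].
  move=> mf; have := mf measurableT `]-oo, y]%classic (measurable_itv _).
  by rewrite setTI (_ : _ @^-1` _ = [set w | (f w <= y)%R])//;
    apply/seteqP; split => w /=; rewrite in_itv.
apply/lee_addgt0Pr => _/posnumP[del].
have cdfE y : cdf Y y = P [set w | (Y w <= y)%R].
  by rewrite /cdf /distribution /pushforward; congr (P _);
    apply/seteqP; split => w /=; rewrite in_itv.
have finP (A : set T) : measurable A -> P A \is a fin_num by exact: fin_num_measure.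
have mY y : measurable [set w | (Y w <= y)%R] by apply: mle.
(* The argument is shifted by [e] twice, from [S] to [Sn n] and from [Tn n] to [Y]. Of the tolerance
   [del], one half pays for the total shift and one quarter for each deviation. *)
have [e [e0 he]] : exists e, 0 < e /\
    (P [set w | (Y w <= x + 2 * e)%R] <= P [set w | (Y w <= x)%R] + (del%:num / 2)%:E)%E.
  have rc : cdf Y y @[y --> x^'+] --> cdf Y x := @cdf_right_continuous _ _ _ _ Y x.
  have xr : \forall y \near x^'+, (cdf Y y < cdf Y x + (del%:num / 2)%:E)%E.
    apply: (rc _ (open_ereal_lt' _)); rewrite cdfE -[ltLHS]adde0 lteD2lE ?finP//.
  have xg : \forall y \near x^'+, x < y by exact: nbhs_right_gt.
  have [y [yl xy]] := @filter_ex _ _ (at_right_proper_filter x) _ (filterI xr xg); exists ((y - x) / 2); split.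
    by rewrite divr_gt0 ?subr_gt0.
  by rewrite (_ : x + _ = y); [rewrite -!cdfE ltW|lra].
have cn1 := ae_cvg_in_probability mSn mS cS e0.
have cn2 := ae_cvg_in_probability mTn (measurable_funPT Y) cT e0.
have d4 : (0 < (del%:num / 4)%:E :> \bar R)%E by rewrite lte_fin.
have n1 : \forall n \near \oo, (P [set w | (e < `|Sn n w - S w|)%R] < (del%:num / 4)%:E)%E.
  exact: (cn1 _ (open_ereal_lt' d4)).
have n2 : \forall n \near \oo, (P [set w | (e < `|Tn n w - Y w|)%R] < (del%:num / 4)%:E)%E.
  exact: (cn2 _ (open_ereal_lt' d4)).
have [n [[hn1 hn2] hn]] := @filter_ex _ _ eventually_filter _ (filterI (filterI n1 n2) le_b).
have mgt1 := measurable_gt_norm e (mSn n) mS.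
have mgt2 := measurable_gt_norm e (mTn n) (measurable_funPT Y).
have s1 : (P [set w | (S w <= x)%R] <= P [set w | (Sn n w <= x + e)%R] + (del%:num / 4)%:E)%E.
  apply: (@le_trans _ _ (P ([set w | (Sn n w <= x + e)%R] `|` [set w | (e < `|Sn n w - S w|)%R]))).
    apply: le_measure; rewrite ?inE; [exact: mle| |].
      by apply: measurableU => //; exact: mle.
    move=> w /= Sx; have [h|h] := ltP e `|Sn n w - S w|; [by right|left].
    by move: h; rewrite ler_norml => /andP[_]; lra.
  have h := measureU2 P (mle _ (x + e) (mSn n)) mgt1.
  apply: (le_trans h).
  by rewrite leeD2l// ltW.
have s2 : (P [set w | (Tn n w <= x + e)%R] <= P [set w | (Y w <= x + 2 * e)%R] + (del%:num / 4)%:E)%E.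
  apply: (@le_trans _ _ (P ([set w | (Y w <= x + 2 * e)%R] `|` [set w | (e < `|Tn n w - Y w|)%R]))).
    apply: le_measure; rewrite ?inE; [exact: mle| |].
      by apply: measurableU => //; exact: mle.
    move=> w /= Sx; have [h|h] := ltP e `|Tn n w - Y w|; [by right|left].
    by move: h; rewrite ler_norml => /andP[h _]; lra.
  have h := measureU2 P (mY (x + 2 * e)) mgt2.
  apply: (le_trans h).
  by rewrite leeD2l// ltW.
have s3 := hn (x + e).
move: s1 s2 s3 he.
have -> : P [set w | (S w <= x)%R] = (fine (P [set w | (S w <= x)%R]))%:E.
  by rewrite fineK// finP//; exact: mle.
have -> : P [set w | (Y w <= x)%R] = (fine (P [set w | (Y w <= x)%R]))%:E by rewrite fineK// finP.
have -> : P [set w | (Y w <= x + 2 * e)%R] = (fine (P [set w | (Y w <= x + 2 * e)%R]))%:E.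
  by rewrite fineK// finP.
have -> : P [set w | (Sn n w <= x + e)%R] = (fine (P [set w | (Sn n w <= x + e)%R]))%:E.
  by rewrite fineK// finP//; exact: mle.
have -> : P [set w | (Tn n w <= x + e)%R] = (fine (P [set w | (Tn n w <= x + e)%R]))%:E.
  by rewrite fineK// finP//; exact: mle.
by rewrite -!EFinD !lee_fin; lra.
Qed.

End convergence_in_law.

(** * Centred Gaussian laws of different variances *)

Section gaussian_comparison.
Context {R : realType}.
Variable sigma : R.
Hypothesis sigma0 : 0 < sigma.
Local Notation mu := (@lebesgue_measure R).
Local Notation N := (normal_prob 0 sigma).
Local Notation phi := (normal_pdf 0 sigma).
Local Notation K := (expR (- 2^-1) / Num.sqrt (2 * pi) : R).

Let sn : sigma != 0. Proof. by rewrite gt_eqF. Qed.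

Let phiE x : phi x = (Num.sqrt (2 * pi))^-1 * sigma^-1 * expR (- ((x / sigma) ^+ 2 / 2)).
Proof.
rewrite /normal_pdf (negbTE sn) /normal_peak /normal_fun subr0.
rewrite -mulrnAr sqrtrM ?sqr_ge0// sqrtr_sqr gtr0_norm// invfM.
rewrite -[pi *+ 2]mulr_natl [sigma^-1 * _]mulrC; congr (_ * expR _).
by rewrite -[_ *+ 2]mulr_natl; field.
Qed.

(** The product is invariant under scaling, so the bound [K] is free of [sigma]; this is why the
    final bound does not involve the variance of the [W j]. *)
Let norm_mul_phi x : `|x| * phi x <= K.
Proof.
rewrite phiE; have := mul_gauss_le (normr_ge0 (x / sigma)).
rewrite real_normK ?num_real// normrM normfV (gtr0_norm sigma0) => h.
rewrite (_ : `|x| * _ =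
  (`|x| / sigma * expR (- ((x / sigma) ^+ 2 / 2))) / Num.sqrt (2 * pi)); last by ring.
by rewrite ler_pM2r// invr_gt0 sqrtr_gt0 mulr_gt0// pi_gt0.
Qed.

Let phi_le (x y : R) : `|x| <= `|y| -> phi y <= phi x.
Proof.
move=> xy; rewrite !phiE ler_wpM2l//.
  by rewrite mulr_ge0 ?invr_ge0 ?sqrtr_ge0// ltW.
rewrite ler_expR lerN2 ler_pM2r// !exprMn ler_pM2r; last first.
  by rewrite exprn_gt0// invr_gt0.
by rewrite -(real_normK (num_real x)) -(real_normK (num_real y)) lerXn2r ?nnegrE.
Qed.

Let N_itv_le (a b c : R) : a <= b ->
  (forall x, a < x <= b -> phi x <= c) -> (N `]a, b] <= ((b - a) * c)%:E)%E.
Proof.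
move=> ab h.
apply: (@le_trans _ _ (\int[mu]_(x in `]a, b]) c%:E)%E).
  apply: ge0_le_integral => //=.
  - by move=> x _; rewrite lee_fin normal_pdf_ge0.
  - by apply/measurable_funTS/measurable_EFinP; exact: measurable_normal_pdf.
rewrite integral_cst//= lebesgue_measure_itv/= lte_fin.
case: ifPn => [_|]; first by rewrite -EFinB -EFinM mulrC.
by rewrite -leNgt mule0 lee_fin => ba; rewrite (@le_anti _ _ a b) ?ab// subrr mul0r.
Qed.

Lemma normal_scale_itv (s y : R) : 0 < s ->
  [set x | s * x <= y] = `]-oo, y / s]%classic.
Proof.
by move=> s0; apply/seteqP; split => x /=; rewrite in_itv/= ler_pdivlMr// mulrC.
Qed.

(** The two values differ by the mass between [y / v] and [y / u]. This interval has length |y / v|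
    (v / u - 1), and the density is largest at [y / v], its endpoint nearest to 0, so that
    [norm_mul_phi] bounds the mass by K (v / u - 1). *)
Lemma normal_cdf_scale_le (u v y : R) : 0 < u -> u <= v ->
  (N [set x | (v * x <= y)%R] <=
     N [set x | (u * x <= y)%R] + (K * ((v ^+ 2 - u ^+ 2) / u ^+ 2 / 2))%:E)%E /\
  (N [set x | (u * x <= y)%R] <=
     N [set x | (v * x <= y)%R] + (K * ((v ^+ 2 - u ^+ 2) / u ^+ 2 / 2))%:E)%E.
Proof.
move=> u0 uv; have v0 : 0 < v by exact: lt_le_trans uv.
rewrite !normal_scale_itv//.
have K0 : 0 <= K by rewrite divr_ge0 ?expR_ge0 ?sqrtr_ge0.
have D0 : 0 <= v / u - 1 by rewrite subr_ge0 ler_pdivlMr ?mul1r.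
(* With r = v / u this is r - 1 <= (r^2 - 1) / 2, that is (r - 1)^2 >= 0. *)
have bound : K * (v / u - 1) <= K * ((v ^+ 2 - u ^+ 2) / u ^+ 2 / 2).
  rewrite ler_wpM2l// (_ : (v ^+ 2 - u ^+ 2) / u ^+ 2 = (v / u) ^+ 2 - 1); last first.
    by field; rewrite gt_eqF.
  by have := sqr_ge0 (v / u - 1); nra.
have N_split a b : a <= b -> (N `]-oo, b] = N `]-oo, a] + N `]a, b])%E.
  move=> ab; rewrite -measureU//.
    by rewrite -itv_bndbnd_setU ?bnd_simp.
  by rewrite -subset0 => x [] /=; rewrite !in_itv/= leNgt => /negP + /andP[].
have N_mono a b : a <= b -> (N `]-oo, a] <= N `]-oo, b])%E.
  by move=> ab; rewrite (N_split _ _ ab) leeDl.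
have yvu : `|y / v| * (v / u - 1) = `|y / u - y / v|.
  rewrite (_ : y / u - y / v = y / v * (v / u - 1)); last by field; rewrite !gt_eqF.
  by rewrite [RHS]normrM (ger0_norm D0).
have key : `|y / u - y / v| * phi (y / v) <= K * ((v ^+ 2 - u ^+ 2) / u ^+ 2 / 2).
  rewrite -yvu; apply: le_trans bound.
  by rewrite mulrAC ler_wpM2r// norm_mul_phi.
have rhs0 : (0 <= (K * ((v ^+ 2 - u ^+ 2) / u ^+ 2 / 2))%:E :> \bar R)%E.
  rewrite lee_fin; apply: le_trans bound; exact: mulr_ge0.
have [y0|y0] := leP 0 y.
- have yy : y / v <= y / u by rewrite ler_wpM2l// lef_pV2 ?posrE.
  split; first by apply: (le_trans (N_mono _ _ yy)); rewrite leeDl.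
  rewrite (N_split _ _ yy) leeD2l//.
  apply: le_trans (N_itv_le yy (c := phi (y / v)) _) _.
    move=> x /andP[xl _]; apply: phi_le; rewrite !ger0_norm ?divr_ge0 ?(ltW v0)//; first exact: ltW.
    by apply: le_trans (ltW xl); rewrite divr_ge0// ltW.
  by rewrite lee_fin; move: key; rewrite ger0_norm// subr_ge0.
- have yy : y / u <= y / v by rewrite ler_wnM2l ?(ltW y0)// lef_pV2 ?posrE.
  split; last by apply: (le_trans (N_mono _ _ yy)); rewrite leeDl.
  rewrite (N_split _ _ yy) leeD2l//.
  apply: le_trans (N_itv_le yy (c := phi (y / v)) _) _.
    move=> x /andP[_ xl]; apply: phi_le.
    have yv : y / v <= 0 by rewrite pmulr_lle0 ?invr_gt0// ltW.
    by rewrite !ler0_norm//; [rewrite lerN2|exact: le_trans yv].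
  by rewrite lee_fin; move: key; rewrite distrC ger0_norm// subr_ge0.
Qed.

Lemma normal_prob_Ny0 : N `]-oo, 0] = (2^-1)%:E.
Proof.
have mphi : measurable_fun setT (fun x => (phi x)%:E).
  by apply/measurable_EFinP; exact: measurable_normal_pdf.
have sym : N `[0, +oo[ = N `]-oo, 0].
  rewrite /normal_prob ge0_integration_by_substitution0; [|exact: mphi|].
    apply: eq_integral => x _; congr EFin; rewrite !phiE.
    by rewrite mulNr sqrrN.
  by move=> x; rewrite lee_fin normal_pdf_ge0.
have N0 : N `]0, +oo[ = N `[0, +oo[.
  rewrite /normal_prob integral_itv_obnd_cbnd//.
  by apply: measurable_funTS.
have half (z : \bar R) : (z + z = 1 -> z = (2^-1)%:E)%E.
  by case: z => // r [] h; congr EFin; lra.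
apply: half; rewrite -[RHS](probability_setT N).
rewrite -(setUv `]-oo, 0%R]%classic) setCitvl [RHS]measureU//; last first.
  by rewrite -subset0 => x [] /=; rewrite !in_itv/= andbT leNgt => /negP.
by congr (_ + _)%E; rewrite -sym -N0.
Qed.

(** At scale 0 the distribution function jumps from 0 to 1 at the origin, and the value of the other
    one lies on the side of 1/2 nearer to it. *)
Lemma normal_cdf_degenerate_le (v y : R) : 0 <= v ->
  (N [set x | (v * x <= y)%R] <= N [set x | (0 * x <= y)%R] + (2^-1)%:E)%E /\
  (N [set x | (0 * x <= y)%R] <= N [set x | (v * x <= y)%R] + (2^-1)%:E)%E.
Proof.
rewrite le_eqVlt => /predU1P[<-|v0]; first by rewrite leeDl.
rewrite normal_scale_itv//.
have le1 (A : set R) : measurable A -> (N A <= 1)%E.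
  by move=> mA; rewrite -(probability_setT N); apply: le_measure; rewrite ?inE.
have [y0|y0] := leP 0 y.
- have -> : [set x : R | 0 * x <= y] = setT.
    by apply/seteqP; split => // x _ /=; rewrite mul0r.
  rewrite (_ : N setT = 1%E); last exact: probability_setT.
  split.
    by apply: (le_trans (le1 _ _)) => //; rewrite leeDl.
  have : (N `]-oo, 0%R] <= N `]-oo, (y / v)%R])%E.
    apply: le_measure; rewrite ?inE//.
    by apply: subset_itvl; rewrite bnd_simp divr_ge0// ltW.
  rewrite normal_prob_Ny0 => h.
  by apply: le_trans (leeD h (lexx _)); rewrite -EFinD lee_fin; lra.
- have -> : [set x : R | 0 * x <= y] = set0.
    by apply/seteqP; split => // x /=; rewrite mul0r leNgt y0.
  rewrite measure0 add0e; split; last by rewrite adde_ge0.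
  rewrite -normal_prob_Ny0; apply: le_measure; rewrite ?inE//.
  by apply: subset_itvl; rewrite bnd_simp pmulr_lle0 ?invr_gt0// ltW.
Qed.

End gaussian_comparison.

(** * Poisson arrivals *)

Section set_of_nat_cardinality.
Implicit Types (S : set nat) (n k : nat).
Local Open Scope card_scope.

Let initial S n : {fset nat} := [fset j in iota 0 n | j \in S]%fset.

Let mem_initial S n j : (j \in initial S n) = (j < n)%N && (j \in S).
Proof. by rewrite !inE/= mem_iota. Qed.

Let card_initial S n : #|` initial S n| = (\sum_(j < n) ((j : nat) \in S : nat))%N.
Proof.
elim: n => [|n IH].
  by rewrite big_ord0; apply/eqP; rewrite cardfs_eq0; apply/eqP/fsetP => j; rewrite mem_initial.
have [nS|nS] := boolP (n \in S).
  rewrite big_ord_recr/= nS -IH (_ : initial S n.+1 = (n |` initial S n)%fset).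
    by rewrite cardfsU1 mem_initial ltnn/= addnC.
  apply/fsetP => j; rewrite in_fset1U !mem_initial ltnS leq_eqVlt.
  by case: eqP => //= ->; rewrite nS.
rewrite big_ord_recr/= (negbTE nS) addn0 -IH; congr #|` _|.
apply/fsetP => j; rewrite !mem_initial ltnS leq_eqVlt.
by case: eqP => //= ->; rewrite (negbTE nS) andbF.
Qed.

(** Turns the cardinality in [count_event] into a statement on partial sums of indicators, from
    which measurability and upper bounds can be read off. *)
Lemma card_eq_sum_indicator S k : S #= `I_k <->
  exists n0, forall n, (n0 <= n)%N -> (\sum_(j < n) ((j : nat) \in S : nat))%N = k.
Proof.
split=> [Sk|[n0 h]].
  have [n0 Sn0] : exists n0, (S `<=` `I_n0)%classic.
    have /finite_seqP[s Ss] : finite_set S by apply/finite_setP; exists k.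
    exists (\max_(i <- s) i).+1 => j; rewrite Ss /= => js.
    by rewrite ltnS leq_bigmax_seq.
  exists n0 => n n0n; rewrite -card_initial; apply/card_eq_fsetP.
  rewrite (_ : [set` initial S n] = S)//; apply/seteqP; split => j /=.
    by rewrite mem_initial => /andP[_ /set_mem].
  move=> Sj; rewrite mem_initial (mem_set Sj) andbT.
  by apply: leq_trans n0n; exact: Sn0.
rewrite (_ : S = [set` initial S n0]).
  by apply/card_eq_fsetP; rewrite card_initial h.
apply/seteqP; split => j /=; last by rewrite mem_initial => /andP[_ /set_mem].
(* [initial S n0] and [initial S n] are nested and both have [k] elements; hence they are equal and
   contain [j]. *)
move=> Sj; pose n := maxn n0 j.+1.
have : initial S n0 = initial S n.
  apply/eqP; rewrite eqEfcard !card_initial !h ?leq_maxl// leqnn andbT.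
  apply/fsubsetP => i; rewrite !mem_initial => /andP[ii ->]; rewrite andbT.
  by rewrite (leq_trans ii)// leq_maxl.
by move=> ->; rewrite mem_initial (mem_set Sj) andbT leq_maxr.
Qed.

Lemma sum_indicator_le_card S k n : S #= `I_k ->
  (\sum_(j < n) ((j : nat) \in S : nat) <= k)%N.
Proof.
move=> /card_eq_sum_indicator[n0 h]; rewrite -(h (maxn n0 n)) ?leq_maxl//.
rewrite -(big_mkord xpredT (fun j => (j \in S : nat))).
rewrite -(big_mkord xpredT (fun j => (j \in S : nat))).
by rewrite (big_cat_nat_idem _ (leq0n n) (leq_maxr n0 n))/= ?leq_addr.
Qed.

End set_of_nat_cardinality.

Section poisson_pmf_moments.
Context {R : realType}.
Variable h : R.
Hypothesis h0 : 0 < h.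
Local Open Scope ereal_scope.

Lemma poisson_pmf_sum : \sum_(k <oo) (poisson_pmf h k)%:E = 1.
Proof.
have : poisson_prob h 0%N setT = 1 by exact: probability_setT.
rewrite /poisson_prob h0 -nneseries_esumT// => k.
by rewrite lee_fin poisson_pmf_ge0.
Qed.

Let shift (f : nat -> R) : (forall k, 0 <= f k)%R -> f 0%N = 0%R ->
  \sum_(k <oo) (f k)%:E = \sum_(k <oo) (f k.+1)%:E.
Proof.
move=> f0 f00; rewrite nneseries_recl//; last by move=> k; rewrite lee_fin.
rewrite f00 add0e -(@nneseries_addn _ (fun k => (f k)%:E) 1)//.
by under eq_eseriesr do rewrite addn1.
Qed.

(** With a shift of the index, this recurrence reduces each moment to the preceding ones. *)
Let pmfS k : (k.+1%:R * poisson_pmf h k.+1 = h * poisson_pmf h k)%R.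
Proof.
rewrite /poisson_pmf h0 factS natrM exprS.
have : (k.+1%:R != 0 :> R)%R by rewrite pnatr_eq0.
have : (k`!%:R != 0 :> R)%R by rewrite pnatr_eq0 -lt0n fact_gt0.
move: (k.+1%:R : R) (k`!%:R : R) => a b b0 a0.
by field; rewrite a0 b0.
Qed.

Lemma poisson_pmf_mean : \sum_(k <oo) (k%:R * poisson_pmf h k)%:E = h%:E.
Proof.
rewrite shift; last by rewrite mul0r.
  under eq_eseriesr do rewrite pmfS EFinM.
  rewrite nneseriesZl; last by move=> k _; rewrite lee_fin poisson_pmf_ge0.
  by rewrite poisson_pmf_sum mule1.
by move=> k; rewrite mulr_ge0 ?poisson_pmf_ge0.
Qed.

Lemma poisson_pmf_moment2 :
  \sum_(k <oo) (k%:R ^+ 2 * poisson_pmf h k)%:E = (h + h ^+ 2)%:E.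
Proof.
have p0 k : (0 <= poisson_pmf h k)%R by exact: poisson_pmf_ge0.
rewrite (shift (f := fun k => k%:R ^+ 2 * poisson_pmf h k)%R); last 2 first.
- by move=> k; rewrite mulr_ge0.
- by rewrite expr0n mul0r.
transitivity (\sum_(k <oo) (h%:E * ((k%:R * poisson_pmf h k)%:E + (poisson_pmf h k)%:E))).
  apply: eq_eseriesr => k _; rewrite -EFinD -EFinM; congr EFin.
  rewrite expr2 -mulrA pmfS -[k.+1%:R]natr1; ring.
rewrite nneseriesZl; last first.
  by move=> k _; rewrite adde_ge0// lee_fin// mulr_ge0.
rewrite nneseriesD; last 2 first.
- by move=> k _; rewrite lee_fin// mulr_ge0.
- by move=> k _; rewrite lee_fin.
by rewrite poisson_pmf_sum poisson_pmf_mean -EFinD -EFinM; congr EFin; ring.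
Qed.

End poisson_pmf_moments.

Lemma nneseries_ge_term {R : realType} (u : (\bar R)^nat) k :
  (forall n, 0 <= u n)%E -> (u k <= \sum_(n <oo) u n)%E.
Proof.
move=> u0; apply: (@le_trans _ _ (\sum_(0 <= i < k.+1) u i)%E).
  by rewrite big_nat_recr//= leeDr// sume_ge0.
exact: nneseries_lim_ge.
Qed.

Lemma ae_eq_measure d (T : measurableType d) (R : realType)
    (mu : {measure set T -> \bar R}) (A B : set T) :
  measurable A -> measurable B -> {ae mu, forall w, A w <-> B w} -> mu A = mu B.
Proof.
move=> mA mB AB; rewrite -[in LHS](setIT A) -[in RHS](setIT B).
rewrite -!integral_indic//; apply: ae_eq_integral => //.
- by apply/measurable_EFinP; exact: measurable_indic.
- by apply/measurable_EFinP; exact: measurable_indic.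
- apply: filterS AB => w wAB _; rewrite !indicE.
  by congr ((_ : bool)%:R%:E); exact: asbool_equiv_eq.
Qed.

Section poisson_arrivals.
Context d (T : measurableType d) (R : realType) (P : probability T R).
Variable G : nat -> {RV P >-> R}.
Hypothesis G_poisson : unit_poisson_arrivals G.

(** The restriction to the first [n] arrivals makes the count finite everywhere and fits the partial
    sums of the series; the moment bounds below are uniform in [n]. *)
Definition arrival_count (A : set R) n w : R := \sum_(j < n) \1_A (G j w).

Local Notation cnt := arrival_count.
Local Notation idx A w := [set j | A (G j w)].

Let cntE A n w : cnt A n w = (\sum_(j < n) ((j : nat) \in idx A w : nat))%:R.
Proof.
rewrite /cnt natr_sum; apply: eq_bigr => j _; rewrite indicE.
by congr (_%:R); congr nat_of_bool; exact: asbool_equiv_eq.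
Qed.

Lemma arrival_count_ge0 A n w : 0 <= cnt A n w.
Proof. by rewrite cntE. Qed.

Lemma measurable_arrival_count A n : measurable A ->
  measurable_fun setT (cnt A n).
Proof.
move=> mA; apply: measurable_sum => j.
by apply: measurableT_comp => //; exact: measurable_indic.
Qed.

Lemma arrival_count_le A n k w : count_event G A k w -> cnt A n w <= k%:R.
Proof. by move=> Ak; rewrite cntE ler_nat sum_indicator_le_card. Qed.

Lemma measurable_count_event A k : measurable A -> measurable (count_event G A k).
Proof.
move=> mA.
have -> : count_event G A k =
    \bigcup_n0 \bigcap_(n in [set n | (n0 <= n)%N]) (cnt A n @^-1` [set k%:R]).
  apply/seteqP; split => w.
    move=> /card_eq_sum_indicator[n0 h]; exists n0 => // n /= n0n.
    by rewrite cntE h.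
  move=> [n0 _ h]; apply/card_eq_sum_indicator; exists n0 => n n0n.
  by have := h n n0n; rewrite /= cntE => /eqP; rewrite eqr_nat => /eqP.
apply: bigcup_measurable => n0 _; apply: bigcap_measurableType => n _.
by rewrite -[X in measurable X]setTI; exact: measurable_arrival_count.
Qed.

(** The disjoint events of exactly [k] arrivals have the Poisson weights as probabilities, and these
    add up to 1. *)
Lemma ae_arrival_count_finite a b : 0 <= a -> a < b ->
  {ae P, forall w, exists k, count_event G `]a, b] k w}.
Proof.
move=> a0 ab; have mI : measurable (`]a, b]%classic : set R) by exact: measurable_itv.
have mc k := measurable_count_event k mI.
exists (~` \bigcup_k count_event G `]a, b] k); split.
- by apply: measurableC; exact: bigcup_measurable.
- rewrite probability_setC; last exact: bigcup_measurable.
  rewrite (_ : P _ = 1%E) ?subee//.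
  rewrite measure_bigcup//=; last first.
    apply/trivIsetP => i j _ _ ij; rewrite -subset0 => w [wi wj].
    case/negP: ij; apply/eqP/card_eq_II.
    by apply: card_eq_trans wj; rewrite card_eq_sym.
  rewrite -(@poisson_pmf_sum _ (b - a)) ?subr_gt0//.
  rewrite (@eq_eseriesl _ _ xpredT); last by move=> i; rewrite in_setT.
  apply: eq_eseriesr => k _; exact: (poisson_increments G_poisson).
- by apply: subsetC => w [k _ wk]; exists k.
Qed.

(** Where the interval holds exactly [k] arrivals the partial count is at most [k]. Its square is
    thus dominated by the series of the [u k], whose expectation is the second Poisson moment. *)
Lemma arrival_count_moment2 a b n : 0 <= a -> a < b ->
  (\int[P]_w (cnt `]a, b] n w ^+ 2)%:E <= ((b - a) + (b - a) ^+ 2)%:E)%E.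
Proof.
move=> a0 ab; have mI : measurable (`]a, b]%classic : set R) by exact: measurable_itv.
have mc k := measurable_count_event k mI.
rewrite -poisson_pmf_moment2 ?subr_gt0//.
pose u k w : \bar R := (k%:R ^+ 2 * \1_(count_event G `]a, b] k) w)%:E.
have u0 k w : (0 <= u k w)%E by rewrite lee_fin mulr_ge0.
have mu k : measurable_fun setT (u k).
  by apply/measurable_EFinP; apply: measurable_funM => //; exact: measurable_indic.
apply: (@le_trans _ _ (\int[P]_w \sum_(k <oo) u k w)%E).
  apply: ae_ge0_le_integral => //.
  - by move=> w _; rewrite lee_fin sqr_ge0.
  - apply/measurable_EFinP; apply: measurable_funX.
    exact: measurable_arrival_count.
  - by move=> w _; apply: nneseries_ge0.
  - exact: ge0_emeasurable_sum.
  - apply: filterS (ae_arrival_count_finite a0 ab) => w [k wk] _.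
    apply: le_trans (nneseries_ge_term k (u0^~ w)).
    rewrite /u indicE (mem_set wk) mulr1 lee_fin lerXn2r ?nnegrE ?arrival_count_ge0//.
    exact: arrival_count_le.
rewrite integral_nneseries// le_eqVlt; apply/orP; left; apply/eqP.
apply: eq_eseriesr => k _; rewrite /u.
under eq_integral do rewrite EFinM.
rewrite ge0_integralZl//; last first.
  by apply/measurable_EFinP; exact: measurable_indic.
rewrite integral_indic// setIT [RHS]EFinM; congr (_ * _)%E.
exact: (poisson_increments G_poisson).
Qed.

(** The same domination by a double series over the two counts; independence of the increments
    factors its expectation into a product of two Poisson means. *)
Lemma arrival_count_mixed_moment a b a' b' n : 0 <= a -> a < b -> 0 <= a' -> a' < b' ->
  `]a, b] `&` `]a', b'] = (set0 : set R) ->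
  (\int[P]_w (cnt `]a, b] n w * cnt `]a', b'] n w)%:E <=
    ((b - a) * (b' - a'))%:E)%E.
Proof.
move=> a0 ab a0' ab' disj.
have mI : measurable (`]a, b]%classic : set R) by exact: measurable_itv.
have mI' : measurable (`]a', b']%classic : set R) by exact: measurable_itv.
have mc k := measurable_count_event k mI.
have mc' k := measurable_count_event k mI'.
have indep k l : P (count_event G `]a, b] k `&` count_event G `]a', b'] l) =
    (poisson_pmf (b - a) k * poisson_pmf (b' - a') l)%:E.
  pose aa (i : 'I_2) := if i == ord0 then a else a'.
  pose bb (i : 'I_2) := if i == ord0 then b else b'.
  pose kk (i : 'I_2) := if i == ord0 then k else l.
  have := @independent_increments _ _ _ _ _ G_poisson 2 aa bb kk.
  have h1 i : 0 <= aa i < bb i.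
    by rewrite /aa /bb; case: ifP => _; apply/andP.
  have h2 : trivIset setT (fun i => [set` `]aa i, bb i]]).
    apply/trivIsetP => i j _ _; rewrite /aa /bb.
    by case: (altP (i =P ord0)) => [->|]; case: (altP (j =P ord0)) => [->|] //;
      [rewrite setIC|case: i j => [[|[|//]] ?] [[|[|//]] ?]//].
  move=> /(_ h1 h2) /(_ [fset ord0; ord_max]%fset).
  rewrite big_fsetU1 ?inE//= big_seq_fset1 /aa /bb /kk/=.
  rewrite !(poisson_increments G_poisson)//= => <-; congr (P _).
  apply/seteqP; split => w.
    move=> [h h'] i /=; rewrite !inE => /orP[|] /eqP ->; first by rewrite eqxx.
    by [].
  move=> h; split.
    by have := h ord0; rewrite /= ?eqxx; apply; rewrite !inE ?eqxx.
  by have := h ord_max; apply; rewrite /= !inE ?eqxx ?orbT.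
have h0 : 0 < b - a by rewrite subr_gt0.
have h0' : 0 < b' - a' by rewrite subr_gt0.
pose v k l w : \bar R := (k%:R * l%:R *
  \1_(count_event G `]a, b] k `&` count_event G `]a', b'] l) w)%:E.
have v0 k l w : (0 <= v k l w)%E by rewrite lee_fin mulr_ge0.
have mv k l : measurable_fun setT (v k l).
  apply/measurable_EFinP; apply: measurable_funM => //; apply: measurable_indic.
  exact: measurableI.
have mvs k : measurable_fun setT (fun w => \sum_(l <oo) v k l w)%E.
  exact: ge0_emeasurable_sum.
have vs0 k w : (0 <= \sum_(l <oo) v k l w)%E by exact: nneseries_ge0.
apply: (@le_trans _ _ (\int[P]_w \sum_(k <oo) \sum_(l <oo) v k l w)%E).
  apply: ae_ge0_le_integral => //.
  - by move=> w _; rewrite lee_fin mulr_ge0// arrival_count_ge0.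
  - apply/measurable_EFinP; apply: measurable_funM; exact: measurable_arrival_count.
  - by move=> w _; apply: nneseries_ge0.
  - exact: ge0_emeasurable_sum.
  - apply: filterS2 (ae_arrival_count_finite a0 ab) (ae_arrival_count_finite a0' ab').
    move=> w [k wk] [l wl] _.
    apply: le_trans (nneseries_ge_term k (vs0^~ w)).
    apply: le_trans (nneseries_ge_term l (v0 k ^~ w)).
    rewrite /v indicE mem_set//= mulr1 lee_fin.
    by apply: ler_pM; rewrite ?arrival_count_ge0//; exact: arrival_count_le.
rewrite integral_nneseries//.
rewrite le_eqVlt; apply/orP; left; apply/eqP.
transitivity (\sum_(k <oo) ((b' - a')%:E * (k%:R * poisson_pmf (b - a) k)%:E))%E; last first.
  rewrite nneseriesZl; last by move=> k _; rewrite lee_fin mulr_ge0// poisson_pmf_ge0.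
  by rewrite poisson_pmf_mean// -EFinM mulrC.
apply: eq_eseriesr => k _.
rewrite integral_nneseries//.
transitivity (\sum_(l <oo) ((k%:R * poisson_pmf (b - a) k)%:E * (l%:R * poisson_pmf (b' - a') l)%:E))%E; last first.
  rewrite nneseriesZl; last by move=> l _; rewrite lee_fin mulr_ge0// poisson_pmf_ge0.
  by rewrite poisson_pmf_mean// muleC.
apply: eq_eseriesr => l _; rewrite /v.
under eq_integral do rewrite EFinM.
rewrite ge0_integralZl//; last first.
  by apply/measurable_EFinP; apply: measurable_indic; exact: measurableI.
rewrite integral_indic//; last exact: measurableI.
rewrite setIT.
transitivity ((k%:R * l%:R)%:E * (poisson_pmf (b - a) k * poisson_pmf (b' - a') l)%:E)%E.
  by congr (_ * _)%E; exact: indep.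
by rewrite -!EFinM; congr EFin; ring.
Qed.

Lemma ae_arrivals_positive : {ae P, forall w, (forall j, 0 < G j w) /\
  forall i j, (i <= j)%N -> G i w <= G j w}.
Proof.
apply: filterS (arrivals_increasing G_poisson) => w [G0 Gi].
have mono i j : (i <= j)%N -> G i w <= G j w.
  move=> /subnK <-; elim: (j - i)%N => // k IH.
  by rewrite addSn; apply: le_trans IH _; exact: ltW.
by split => // j; apply: lt_le_trans G0 _; exact: mono.
Qed.

Lemma ae_arrivals_locally_finite c : 0 < c ->
  {ae P, forall w, finite_set [set j | 0 <= G j w <= c]}.
Proof.
move=> c0; apply: filterS2 ae_arrivals_positive (ae_arrival_count_finite (lexx 0) c0).
move=> w [Gp _] [k wk]; apply/finite_setP; exists k.
rewrite (_ : [set j | _] = idx `]0, c]%classic w)//.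
by apply/seteqP; split => j /=; rewrite in_itv/= Gp ?(ltW (Gp j)).
Qed.

(** Almost surely, [t < G 0] means that ]0, t] holds no arrival. For [t = 0] this interval is empty,
    and positivity of the arrivals is used instead. *)
Lemma first_arrival_tail t : 0 <= t -> P [set w | t < G 0%N w] = (expR (- t))%:E.
Proof.
have mgt s : measurable [set w | s < G 0%N w].
  rewrite (_ : [set w | _] = G 0%N @^-1` `]s, +oo[).
    by apply: measurable_funPTI.
  by apply/seteqP; split => w /=; rewrite in_itv/= andbT.
rewrite le_eqVlt => /predU1P[<-|t0].
  rewrite oppr0 expR0 -(probability_setT P); apply: ae_eq_measure => //.
  by apply: filterS ae_arrivals_positive => w [Gp _]; split => // _; exact: Gp.
have mI : measurable (`]0, t]%classic : set R) by exact: measurable_itv.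
have -> : expR (- t) = poisson_pmf (t - 0) 0.
  by rewrite /poisson_pmf subr0 t0 expr0 fact0 invr1 !mul1r.
rewrite -(poisson_increments G_poisson)//.
apply: ae_eq_measure => //; first exact: measurable_count_event.
apply: filterS ae_arrivals_positive => w [Gp Gmono]; split => /=.
  move=> tG; rewrite /count_event/= (_ : [set j | _] = set0) ?II0//.
  apply/seteqP; split => // j /=; rewrite in_itv/= => /andP[_].
  by rewrite leNgt (lt_le_trans tG)// Gmono.
rewrite /count_event/= II0 card_eq0 => /eqP h.
rewrite ltNge; apply/negP => Gt.
by have : (set0 : set nat) 0%N by rewrite -h/= in_itv/= Gp Gt.
Qed.

End poisson_arrivals.

Section riemann_sums.
Context {R : realType}.
Implicit Types c h q x : R.

Lemma powRN_le x y q : 0 < x -> x <= y -> 0 <= q -> y `^ (- q) <= x `^ (- q).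
Proof.
move=> x0 xy q0; have y0 : 0 < y by exact: lt_le_trans xy.
rewrite !powRN lef_pV2 ?posrE ?powR_gt0//.
by apply: ge0_ler_powR; rewrite // nnegrE ltW.
Qed.

(** The term [i = 0] is kept as it is; each later one is at most the integral over the cell to its
    left, by [powR_step_le]. In [sharp] the subtracted endpoint value is retained so that the sum
    telescopes. *)
Lemma riemann_sum_powR_le c h q n : 0 < c -> 0 <= h -> 1 < q ->
  \sum_(i < n) h * (c + i%:R * h) `^ (- q) <=
  h * c `^ (- q) + c `^ (1 - q) / (q - 1).
Proof.
move=> c0 h0 q1; have q10 : 0 < q - 1 by rewrite subr_gt0.
have ch m : 0 < c + m%:R * h by rewrite ltr_wpDr// mulr_ge0.
have sharp m : \sum_(i < m.+1) h * (c + i%:R * h) `^ (- q) <=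
    h * c `^ (- q) + (c `^ (1 - q) - (c + m%:R * h) `^ (1 - q)) / (q - 1).
  elim: m => [|m IH].
    by rewrite big_ord_recl big_ord0 addr0 /= mul0r addr0 subrr mul0r addr0.
  rewrite big_ord_recr/=.
  have -> : c + m.+1%:R * h = c + m%:R * h + h by rewrite -[m.+1%:R]natr1; ring.
  have st := powR_step_le (ch m) h0 q1.
  apply: le_trans (lerD IH st) _.
  by rewrite le_eqVlt; apply/orP; left; apply/eqP; ring.
case: n => [|n].
  by rewrite big_ord0 addr_ge0 ?mulr_ge0 ?invr_ge0 ?powR_ge0 ?(ltW q10).
apply: le_trans (sharp n) _; rewrite lerD2l ler_pM2r ?invr_gt0//.
by rewrite lerBlDr lerDl powR_ge0.
Qed.

Lemma partition_cover c h x n : c < x -> x <= c + n%:R * h ->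
  exists2 i : nat, (i < n)%N & c + i%:R * h < x <= c + i.+1%:R * h.
Proof.
move=> cx; elim: n => [|n IH] xn.
  by move: xn; rewrite mul0r addr0 leNgt cx.
have [/IH[i il ix]|xgt] := leP x (c + n%:R * h).
  by exists i => //; exact: ltnW.
by exists n => //; rewrite xgt.
Qed.

End riemann_sums.

(** * Second moment of the sum over late arrivals *)

Section poisson_tail_sum.
Context d (T : measurableType d) (R : realType) (P : probability T R).
Variable G : nat -> {RV P >-> R}.
Hypothesis G_poisson : unit_poisson_arrivals G.
Variables (c q : R).
Hypothesis c0 : 0 < c.
Hypothesis q1 : 1 < q.

Definition arrival_sum (A : set R) n w : R :=
  \sum_(j < n) \1_A (G j w) * G j w `^ (- q).

Lemma arrival_sum_ge0 A n w : 0 <= arrival_sum A n w.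
Proof. by apply: sumr_ge0 => j _; rewrite mulr_ge0 ?powR_ge0. Qed.

Lemma measurable_arrival_sum A n : measurable A ->
  measurable_fun setT (arrival_sum A n).
Proof.
move=> mA; apply: measurable_sum => j; apply: measurable_funM.
  by apply: measurableT_comp => //; exact: measurable_indic.
by apply: (measurableT_comp (f := @powR R ^~ (- q))).
Qed.

(** The variance plus the squared mean that Campbell's formulas give for the sum of x^(-q) over the
    points beyond [c] of a unit rate Poisson process. *)
Let bound : R := c `^ (1 - 2 * q) / (2 * q - 1) + (c `^ (1 - q) / (q - 1)) ^+ 2.

Let cell h (i : nat) : set R := `]c + i%:R * h, c + i.+1%:R * h]%classic.

Let arrival_sum_le_partition h N n w : 0 < h ->
  arrival_sum `]c, c + N%:R * h] n w <=
  \sum_(i < N) (c + i%:R * h) `^ (- q) * arrival_count G (cell h i) n w.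
Proof.
move=> h0; rewrite /arrival_count.
under eq_bigr do rewrite mulr_sumr.
rewrite exchange_big/=; apply: ler_sum => j _.
have t0 (i : 'I_N) : 0 <= (c + i%:R * h) `^ (- q) * \1_(cell h i) (G j w).
  by rewrite mulr_ge0 ?powR_ge0.
rewrite indicE; case: (boolP (_ \in _)) => [/set_mem/=|_]; last first.
  by rewrite mul0r sumr_ge0.
rewrite in_itv/= => /andP[cG Gc]; rewrite mul1r.
have [i iN iG] := partition_cover cG Gc.
rewrite (bigD1 (Ordinal iN))//=; apply: (@le_trans _ _ ((c + i%:R * h) `^ (- q))).
  apply: powRN_le; [|by case/andP: iG => /ltW|by apply: le_trans (ltW q1)].
  by rewrite ltr_wpDr// mulr_ge0// ltW.
rewrite indicE mem_set ?mulr1; last by rewrite /cell/= in_itv.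
by rewrite lerDl sumr_ge0.
Qed.

(** In the expanded square every pair of cells contributes at most h^2 and the diagonal a further h.
    With the weights [g i], this makes the square of the sum of h g_i plus the sum of h g_i^2, both
    of which are Riemann sums. *)
Let partition_moment2 h N n : 0 < h ->
  (\int[P]_w (arrival_sum `]c, c + N%:R * h] n w ^+ 2)%:E <=
   (h * c `^ (- (2 * q)) + c `^ (1 - 2 * q) / (2 * q - 1) +
    (h * c `^ (- q) + c `^ (1 - q) / (q - 1)) ^+ 2)%:E)%E.
Proof.
move=> h0; pose g (i : nat) := (c + i%:R * h) `^ (- q).
have g0 i : 0 <= g i by exact: powR_ge0.
pose C (i : nat) w := arrival_count G (cell h i) n w.
have mcell i : measurable (cell h i) by exact: measurable_itv.
have mC i : measurable_fun setT (C i) by exact: measurable_arrival_count.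
have C0 i w : 0 <= C i w by exact: arrival_count_ge0.
have cl i : 0 <= c + i%:R * h by rewrite addr_ge0 ?mulr_ge0// ltW.
have cle i : c + i%:R * h < c + i.+1%:R * h by rewrite ltrD2l ltr_pM2r// ltr_nat.
have clen i : c + i.+1%:R * h - (c + i%:R * h) = h by rewrite -[i.+1%:R]natr1; ring.
have cross (i k : nat) :
    (\int[P]_w (C i w * C k w)%:E <= (h ^+ 2 + (i == k)%:R * h)%:E)%E.
  have [<-|ik] := eqVneq i k.
    under eq_integral do rewrite -expr2.
    have := arrival_count_moment2 G_poisson n (cl i) (cle i).
    by rewrite clen => /le_trans; apply; rewrite lee_fin /= mul1r addrC.
  have := @arrival_count_mixed_moment _ _ _ _ _ G_poisson _ _ _ _ n (cl i) (cle i) (cl k) (cle k).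
  rewrite !clen mul0r addr0 expr2; apply.
  rewrite -subset0 => x []; rewrite /= !in_itv/= => /andP[i1 i2] /andP[k1 k2].
  have le_of (a b : nat) : c + a%:R * h < x -> x <= c + b.+1%:R * h -> (a <= b)%N.
    move=> xa xb; have := lt_le_trans xa xb.
    by rewrite ltrD2l ltr_pM2r// ltr_nat ltnS.
  by case/negP: ik; rewrite eqn_leq (le_of _ _ i1 k2) (le_of _ _ k1 i2).
apply: (@le_trans _ _ (\int[P]_w (\sum_(i < N) \sum_(k < N) (g i * g k)%:E * (C i w * C k w)%:E))%E).
  apply: ge0_le_integral => //=.
  - by move=> w _; rewrite lee_fin sqr_ge0.
  - apply/measurable_EFinP/measurable_funX.
    by apply: measurable_arrival_sum; exact: measurable_itv.
  - apply: emeasurable_sum => i; apply: emeasurable_sum => k.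
    apply: emeasurable_funM => //; apply/measurable_EFinP.
    exact: measurable_funM.
  - move=> w _.
    have -> : (\sum_(i < N) \sum_(k < N) (g i * g k)%:E * (C i w * C k w)%:E)%E =
        ((\sum_(i < N) g i * C i w) ^+ 2)%:E.
      rewrite expr2 mulr_suml -sumEFin; apply: eq_bigr => i _.
      rewrite mulr_sumr -sumEFin; apply: eq_bigr => k _.
      by rewrite -EFinM; congr EFin; ring.
    rewrite lee_fin lerXn2r ?nnegrE ?arrival_sum_ge0//.
      by apply: sumr_ge0 => i _; rewrite mulr_ge0.
    exact: arrival_sum_le_partition.
have mT (i k : nat) : measurable_fun setT (fun w => ((g i * g k)%:E * (C i w * C k w)%:E)%E).
  by apply: emeasurable_funM => //; apply/measurable_EFinP; exact: measurable_funM.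
have T0 (i k : nat) w : (0 <= (g i * g k)%:E * (C i w * C k w)%:E)%E.
  by rewrite -EFinM lee_fin !mulr_ge0.
rewrite ge0_integral_sum//; last 2 first.
- by move=> i; exact: emeasurable_sum.
- by move=> i w _; exact: sume_ge0.
under eq_bigr do rewrite ge0_integral_sum//.
apply: (@le_trans _ _ (\sum_(i < N) \sum_(k < N)
    (g i * g k * (h ^+ 2 + ((i : nat) == k)%:R * h))%:E)%E).
  apply: lee_sum => i _; apply: lee_sum => k _.
  rewrite ge0_integralZl//; last 3 first.
  - by apply/measurable_EFinP; exact: measurable_funM.
  - by move=> w _; rewrite lee_fin mulr_ge0.
  - by rewrite lee_fin mulr_ge0.
  rewrite [leRHS]EFinM lee_wpmul2l// ?lee_fin ?mulr_ge0//; exact: cross.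
under eq_bigr do rewrite sumEFin.
rewrite sumEFin lee_fin.
have -> : \sum_(i < N) \sum_(k < N) g i * g k * (h ^+ 2 + ((i : nat) == k)%:R * h) =
    (\sum_(i < N) h * g i) ^+ 2 + \sum_(i < N) h * g i ^+ 2.
  rewrite [X in X + _]expr2 mulr_suml -big_split/=; apply: eq_bigr => i _.
  under eq_bigr do rewrite mulrDr.
  rewrite big_split/=; congr (_ + _).
    by rewrite mulr_sumr; apply: eq_bigr => k _; ring.
  rewrite (bigD1 i)//= eqxx mul1r big1 ?addr0; first by ring.
  move=> k ki; rewrite (_ : (i == k :> nat) = false) ?mul0r ?mulr0//.
  by apply/negbTE; rewrite eq_sym.
rewrite addrC; apply: lerD.
  have -> : \sum_(i < N) h * g i ^+ 2 = \sum_(i < N) h * (c + i%:R * h) `^ (- (2 * q)).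
    apply: eq_bigr => i _; congr (_ * _).
    rewrite /g -powR_mulrn ?powR_ge0// -powRrM; congr (_ `^ _); ring.
  by apply: riemann_sum_powR_le => //; [exact: ltW|have := q1; lra].
rewrite lerXn2r ?nnegrE//.
- by apply: sumr_ge0 => i _; rewrite mulr_ge0// ltW.
- by rewrite addr_ge0 ?mulr_ge0 ?invr_ge0 ?powR_ge0 ?subr_ge0 ?(ltW h0) ?(ltW q1).
- by apply: riemann_sum_powR_le => //; exact: ltW.
Qed.

Let bounded_moment2 (L : nat) n :
  (\int[P]_w (arrival_sum `]c, c + L.+1%:R] n w ^+ 2)%:E <= bound%:E)%E.
Proof.
apply/lee_addgt0Pr => e e0.
pose u := c `^ (- q); pose a := c `^ (1 - q) / (q - 1).
pose v := c `^ (- (2 * q)); pose b := c `^ (1 - 2 * q) / (2 * q - 1).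
have u0 : 0 <= u by exact: powR_ge0.
have v0 : 0 <= v by exact: powR_ge0.
have a0 : 0 <= a by rewrite /a divr_ge0 ?powR_ge0// subr_ge0 ltW.
(* For h <= 1 the excess h v + h^2 u^2 + 2 h u a over the limit is at most h D. The number [N] of
   cells is such that h (1 + D / e) <= 1, which yields both h <= 1 and h D <= e. *)
pose D := v + u ^+ 2 + 2 * u * a.
have D0 : 0 <= D by have := sqr_ge0 u; rewrite /D; nra.
pose N := (Num.truncn (L.+1%:R * (1 + D / e))).+1.
have Ngt : L.+1%:R * (1 + D / e) < N%:R :> R by exact: truncnS_gt.
have N0 : 0 < N%:R :> R by rewrite ltr0n.
pose h := L.+1%:R / N%:R : R.
have h0 : 0 < h by rewrite divr_gt0.
have De0 : 0 <= D / e by rewrite divr_ge0// ltW.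
have hD : h * (1 + D / e) <= 1 by rewrite /h mulrAC ler_pdivrMr// mul1r ltW.
have h1 : h <= 1 by apply: le_trans hD; apply: ler_peMr; [exact: ltW|rewrite lerDl].
have hDe : h * D <= e.
  have := ler_wpM2r (ltW e0) hD; rewrite mul1r; apply: le_trans.
  rewrite (_ : h * (1 + D / e) * e = h * e + h * D); last by field; rewrite gt_eqF.
  by rewrite lerDr mulr_ge0// ltW.
have -> : c + L.+1%:R = c + N%:R * h by rewrite /h mulrC divfK// gt_eqF.
apply: le_trans (partition_moment2 N n h0) _.
rewrite -EFinD lee_fin -/u -/v -/a -/b /bound -/a -/b.
have uu : 0 <= u ^+ 2 by exact: sqr_ge0.
have : h ^+ 2 * u ^+ 2 <= h * u ^+ 2.
  by rewrite ler_wpM2r// expr2 ler_piMr// ltW.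
by move: hDe; rewrite /D; nra.
Qed.

(** Monotone convergence in the length of the interval; for each [w] the [n] arrivals involved are
    all covered from some [L] on. *)
Lemma arrival_tail_sum_moment2 n :
  (\int[P]_w (arrival_sum `]c, +oo[ n w ^+ 2)%:E <= bound%:E)%E.
Proof.
pose f (L : nat) w : \bar R := (arrival_sum `]c, c + L.+1%:R] n w ^+ 2)%:E.
have mf L : measurable_fun setT (f L).
  apply/measurable_EFinP/measurable_funX.
  by apply: measurable_arrival_sum; exact: measurable_itv.
have f0 L w : (0 <= f L w)%E by rewrite lee_fin sqr_ge0.
have ndf w : {homo f ^~ w : L L' / (L <= L')%N >-> (L <= L')%E}.
  move=> L L' LL; rewrite lee_fin lerXn2r ?nnegrE ?arrival_sum_ge0//.
  apply: ler_sum => j _; rewrite ler_wpM2r ?powR_ge0//.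
  rewrite !indicE ler_nat; case: (boolP (_ \in _)) => // /set_mem /=.
  rewrite in_itv/= => /andP[cG Gc]; rewrite mem_set//= in_itv/= cG/=.
  by apply: (le_trans Gc); rewrite lerD2l ler_nat.
have -> : (\int[P]_w (arrival_sum `]c, +oo[ n w ^+ 2)%:E = \int[P]_w limn (f ^~ w))%E.
  apply: eq_integral => w _; apply/esym/cvg_lim => //.
  have : \forall L \near \oo, forall j : 'I_n, G j w - c <= L.+1%:R.
    exists (\max_(j < n) (Num.truncn (G j w - c))) => // L /= maxL k.
    apply/ltW/(lt_le_trans (truncnS_gt _)); rewrite ler_nat ltnS.
    apply: leq_trans maxL.
    exact: (leq_bigmax (F := fun j : 'I_n => Num.truncn (G j w - c))).
  move=> large; apply: cvg_near_cst; apply: filterS large => L GL.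
  congr ((_ ^+ 2)%:E); apply: eq_bigr => j _; congr (_ * _).
  rewrite !indicE; congr (_%:R); congr nat_of_bool.
  apply: asbool_equiv_eq; rewrite /= !in_itv/= andbT.
  suff -> : G j w <= c + L.+1%:R by rewrite andbT.
  by rewrite -lerBlDl.
rewrite monotone_convergence//.
apply: lime_le; last by apply: nearW => L; exact: bounded_moment2.
apply: ereal_nondecreasing_is_cvgn => L L' LL.
by apply: ge0_le_integral => // w _; exact: ndf.
Qed.

End poisson_tail_sum.

(** * The exponential law and the gamma function *)

Section exponential_moments.
Context {R : realType}.
Local Notation mu := (@lebesgue_measure R).

(** The function x^p exp(-x / 2) is maximal at x = 2 p, where it is at most (2 p)^p; the other
    factor exp(-x / 2) is twice the exponential density of rate 1/2. *)
Let gamma_integrand_le (p x : R) : 0 < p -> 0 < x ->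
  x `^ p * expR (- x) <= 2 * (2 * p) `^ p * exponential_pdf 2^-1 x.
Proof.
move=> p0 x0; rewrite exponential_pdfE ?(ltW x0)//.
have -> : 2 * (2 * p) `^ p * (2^-1 * expR (- 2^-1 * x)) =
    (2 * p) `^ p * expR (- 2^-1 * x) by field.
have pp0 : 0 < 2 * p by rewrite mulr_gt0.
rewrite /powR !gt_eqF// -!expRD ler_expR.
have : ln (x / (2 * p)) <= x / (2 * p) - 1.
  have := expR_ge1Dx (ln (x / (2 * p))); rewrite lnK ?posrE ?divr_gt0//; lra.
rewrite ln_div ?posrE// => h.
have : p * (ln x - ln (2 * p)) <= p * (x / (2 * p) - 1) by rewrite ler_pM2l.
rewrite [X in _ <= X](_ : _ = x / 2 - p); last by field; rewrite gt_eqF.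
lra.
Qed.

Let mgamma (p : R) : measurable_fun setT (fun x : R => (x `^ p * expR (- x))%:E).
Proof.
apply/measurable_EFinP; apply: measurable_funM; first exact: measurable_powR.
by apply: measurableT_comp => //; exact: measurable_funN.
Qed.

(** [Gamma_fun] is a real-valued integral, which would default to 0 if the integral were infinite;
    finiteness identifies the two in [Gamma_funE]. *)
Lemma gamma_integral_lty (p : R) : 0 < p ->
  (\int[mu]_(x in `]0%R, +oo[) (x `^ p * expR (- x))%:E < +oo)%E.
Proof.
move=> p0; have mpdf : measurable_fun setT (fun x : R => (exponential_pdf 2^-1 x)%:E).
  by apply/measurable_EFinP; exact: measurable_exponential_pdf.
have pdf0 (x : R) : 0 <= exponential_pdf 2^-1 x by apply: exponential_pdf_ge0.
apply: (@le_lt_trans _ _ (\int[mu]_x ((2 * (2 * p) `^ p)%:E * (exponential_pdf 2^-1 x)%:E))%E).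
  apply: (@le_trans _ _ (\int[mu]_(x in `]0%R, +oo[)
      ((2 * (2 * p) `^ p)%:E * (exponential_pdf 2^-1 x)%:E))%E).
    apply: ge0_le_integral => //=.
    - by move=> x _; rewrite lee_fin mulr_ge0 ?powR_ge0 ?expR_ge0.
    - by apply: measurable_funTS; exact: mgamma.
    - by apply: measurable_funTS; exact: emeasurable_funM.
    - move=> x; rewrite in_itv/= andbT => x0.
      by rewrite -EFinM lee_fin gamma_integrand_le.
  apply: ge0_subset_integral => //=; first exact: emeasurable_funM.
  by move=> x _; rewrite -EFinM lee_fin mulr_ge0// mulr_ge0// powR_ge0.
rewrite ge0_integralZl//; last 2 first.
- by move=> x _; rewrite lee_fin.
- by rewrite lee_fin mulr_ge0// powR_ge0.
by rewrite integral_exponential_pdf// mule1 ltry.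
Qed.

Lemma Gamma_funE (p : R) : 0 < p ->
  (\int[mu]_(x in `]0%R, +oo[) (x `^ p * expR (- x))%:E = (Gamma_fun (p + 1))%:E)%E.
Proof.
move=> p0; rewrite /Gamma_fun /Rintegral.
under [in RHS]eq_integral do rewrite addrK.
rewrite fineK// ge0_fin_numE ?gamma_integral_lty//.
by apply: integral_ge0 => x _; rewrite lee_fin mulr_ge0 ?powR_ge0 ?expR_ge0.
Qed.

Let expm : {measure set (measurableTypeR R) -> \bar R}.
Proof. by refine (exponential_prob 1). Defined.

Let expmT : expm setT = 1%E.
Proof. by rewrite /= /exponential_prob integral_exponential_pdf. Qed.

Let expm_tail (t : R) : 0 <= t -> expm `]t, +oo[%classic = (expR (- t))%:E.
Proof.
move=> t0; have cexp : continuous (fun x : R => expR (- x)).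
  by move=> x; apply: continuous_comp; [exact: continuousN|exact: continuous_expR].
transitivity (\int[mu]_(x in `]t, +oo[) (expR (- x))%:E)%E.
  apply: eq_integral => x; rewrite inE/= in_itv/= andbT => tx.
  by rewrite exponential_pdfE ?(le_trans t0 (ltW tx))// mul1r mulN1r.
rewrite integral_itv_obnd_cbnd; last first.
  apply: measurable_funTS; apply/measurable_EFinP.
  exact: continuous_measurable_fun.
rewrite (@ge0_continuous_FTC2y _ _ (fun x => - expR (- x)) _ 0).
- by rewrite EFinN oppeK add0e.
- by move=> x _; exact: expR_ge0.
- exact: continuous_subspaceT.
- by rewrite -oppr0; apply: cvgN; exact: cvgr_expR.
- by [].
- by apply: cvgN; apply/cvg_at_right_filter; exact: cexp.
- move=> x _; rewrite derive1N// derive1_comp// derive1N// derive1_id derive1E.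
  by have /funeqP -> := @derive_expR R; rewrite mulrN1 opprK.
Qed.

(** The rays ]t, +oo[ form a pi-system generating the Borel sets, so the tail determines the law of
    [Y]. *)
Lemma ge0_integral_exponential_tail d (T : measurableType d) (P : probability T R)
    (Y : {RV P >-> R}) (f : R -> \bar R) :
  (forall t, 0 <= t -> P [set w | t < Y w] = (expR (- t))%:E) ->
  measurable_fun setT f -> (forall x, 0 <= f x)%E ->
  (\int[P]_w f (Y w) = \int[mu]_(x in `]0%R, +oo[) (f x * (expR (- x))%:E))%E.
Proof.
move=> tail mf f0.
have mY : measurable_fun setT (Y : T -> measurableTypeR R).
  by move=> _ A mA; rewrite setTI; exact: measurable_funPTI.
pose push : {measure set (measurableTypeR R) -> \bar R} :=
  ltac:(by refine (pushforward P (Y : T -> measurableTypeR R))).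
have pushE t : push `]t, +oo[%classic = P [set w | t < Y w].
  by congr (P _); apply/seteqP; split => w /=; rewrite in_itv/= andbT.
have mray t : measurable [set w | t < Y w].
  rewrite (_ : [set w | _] = Y @^-1` `]t, +oo[); first exact: measurable_funPTI.
  by apply/seteqP; split => w /=; rewrite in_itv/= andbT.
have GI : setI_closed (@RGenOInfty.G R).
  move=> _ _ [x ->] [y ->]; exists (Num.max x y).
  by apply/seteqP; split => z /=; rewrite !in_itv/= !andbT gt_max => /andP.
have Gg n : @RGenOInfty.G R (`](- n%:R), +oo[%classic) by exists (- n%:R).
have Gcover : \bigcup_n `](- n%:R), +oo[%classic = [set: R].
  rewrite -subTset => x _; exists (Num.truncn `|x|).+1 => //=.
  rewrite in_itv/= andbT ltrNl.
  by apply: le_lt_trans (truncnS_gt _); rewrite -normrN ler_norm.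
have eqG A : @RGenOInfty.G R A -> push A = expm A.
  move=> [t ->]; have [t0|t0] := leP 0 t; first by rewrite pushE tail// expm_tail.
  (* For [t < 0] the ray contains ]0, +oo[, which already has mass 1 under both laws. *)
  transitivity (1%E : \bar R).
    rewrite pushE; apply/eqP; rewrite eq_le probability_le1//=.
    rewrite -expR0 -oppr0 -tail//; apply: le_measure; rewrite ?inE//.
    by move=> w /=; apply: lt_trans.
  apply/esym/eqP; rewrite eq_le -{1}expmT -expR0 -oppr0 -expm_tail//.
  apply/andP; split; apply: le_measure; rewrite ?inE//.
  by move=> w /=; rewrite !in_itv/= !andbT; apply: lt_trans.
have push_lty n : (push `](- n%:R)%R, +oo[%classic < +oo)%E.
  by rewrite pushE (le_lt_trans (probability_le1 _ _))// ltry.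
have lawE := @measure_unique _ R (measurableTypeR R) _ _
  (@RGenOInfty.measurableE R) GI Gg Gcover push expm eqG push_lty.
transitivity (\int[push]_y f y)%E; first by rewrite ge0_integral_pushforward.
transitivity (\int[expm]_y f y)%E.
  by apply: eq_measure_integral => A mA _; exact: lawE.
have mpdf : measurable_fun setT (exponential_pdf (1 : R)) by exact: measurable_exponential_pdf.
rewrite (@ge0_integral_density _ _ _ mu expm _ mpdf)//; last first.
  by move=> x; exact: exponential_pdf_ge0.
have mfe : measurable_fun setT (fun x : R => (f x * (expR (- x))%:E)%E).
  apply: emeasurable_funM => //; apply/measurable_EFinP.
  by apply: measurableT_comp => //; exact: measurable_funN.
rewrite integral_itv_obnd_cbnd; last exact: measurable_funTS.
rewrite [RHS]integral_mkcond; apply: eq_integral => x _.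
rewrite patchE /exponential_pdf patchE; case: ifP => _; last by rewrite mule0.
by rewrite mul1r mulN1r.
Qed.

End exponential_moments.

Section first_arrival.
Context d (T : measurableType d) (R : realType) (P : probability T R).
Variable G : nat -> {RV P >-> R}.
Hypothesis G_poisson : unit_poisson_arrivals G.

Lemma first_arrival_moment (p : R) : 0 < p ->
  (\int[P]_w (G 0%N w `^ p)%:E = (Gamma_fun (p + 1))%:E)%E.
Proof.
move=> p0; have mp : measurable_fun setT (fun x : R => (x `^ p)%:E).
  by apply/measurable_EFinP; exact: measurable_powR.
rewrite (@ge0_integral_exponential_tail _ _ _ P (G 0%N) (fun x => (x `^ p)%:E))//.
- by rewrite -Gamma_funE.
- by move=> t t0; exact: first_arrival_tail.
- by move=> x; rewrite lee_fin powR_ge0.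
Qed.

(** Markov's inequality for [G 0], whose moment of order [p] is the right-hand side. *)
Lemma Gamma_fun_ge (p t : R) : 0 < p -> 0 <= t ->
  t `^ p * expR (- t) <= Gamma_fun (p + 1).
Proof.
move=> p0 t0; rewrite -lee_fin -first_arrival_moment// EFinM.
have mtail : measurable [set w | t < G 0%N w].
  rewrite (_ : [set w | _] = G 0%N @^-1` `]t, +oo[); first exact: measurable_funPTI.
  by apply/seteqP; split => w /=; rewrite in_itv/= andbT.
rewrite -(first_arrival_tail G_poisson t0) -[X in P X]setIT -integral_indic//.
have mi : measurable_fun setT (fun w => (\1_[set w | t < G 0%N w] w)%:E : \bar R).
  by apply/measurable_EFinP; exact: measurable_indic.
rewrite -ge0_integralZl//; last by rewrite lee_fin powR_ge0.
apply: ge0_le_integral => //=.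
- by move=> w _; rewrite -EFinM lee_fin mulr_ge0 ?powR_ge0.
- by apply: emeasurable_funM.
- apply/measurable_EFinP; apply: (measurableT_comp (f := @powR R ^~ p)) => //.
- move=> w _; rewrite -EFinM lee_fin indicE; case: (boolP (_ \in _)) => [/set_mem/= h|_].
    rewrite mulr1; apply: ge0_ler_powR; rewrite ?nnegrE ?(ltW p0) ?(ltW h)//.
    exact: le_trans (ltW h).
  by rewrite mulr0 powR_ge0.
Qed.

(* The choice [t = 2 c] in [Gamma_fun_ge] makes both sides decay like [expR (- 2 * c)],
   which leaves an inequality in [p] alone. *)
Lemma void_probability_le (c p : R) : 1 < c -> 2 < p ->
  expR (- c) <= expR (- 2^-1) / Num.sqrt (2 * pi) *
    Num.sqrt (Gamma_fun (p + 1) *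
      (c `^ (1 - p) / (p - 1) + (c `^ (1 - p / 2) / (p / 2 - 1)) ^+ 2)).
Proof.
move=> c1 p2; have c0 : 0 < c by lra.
have p0 : 0 < p by lra.
have pi0 := @pi_gt0 R.
set M := c `^ (1 - p) / _ + _.
(* As [c > 1], the exponents 1 - p and 2 - p of [c] may be lowered to -p, which cancels the factor
   c^p of (2 c)^p. *)
have Mge : c `^ (- p) * ((p - 1)^-1 + 4 / (p - 2) ^+ 2) <= M.
  rewrite mulrDr /M; apply: lerD.
    rewrite ler_pM2r ?invr_gt0 ?subr_gt0; last by lra.
    by apply: ler_powR; lra.
  rewrite exprMn -[(c `^ _) ^+ 2]powR_mulrn ?powR_ge0// -powRrM exprVn.
  rewrite (_ : (p / 2 - 1) ^+ 2 = (p - 2) ^+ 2 / 4); last by field.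
  rewrite invf_div ler_pM2r; last by rewrite divr_gt0// exprn_gt0// subr_gt0.
  by apply: ler_powR; lra.
have M0 : 0 <= M by rewrite addr_ge0 ?sqr_ge0// divr_ge0 ?powR_ge0//; lra.
have c20 : 0 <= 2 * c by lra.
have Gge := Gamma_fun_ge p0 c20.
have G0 : 0 <= Gamma_fun (p + 1).
  by apply: le_trans Gge; rewrite mulr_ge0 ?powR_ge0 ?expR_ge0.
have s0 : 0 < Num.sqrt (2 * pi) :> R by rewrite sqrtr_gt0 mulr_gt0.
rewrite mulrAC ler_pdivlMr//.
rewrite -(@ler_pXn2r _ 2) ?nnegrE ?(mulr_ge0, expR_ge0, sqrtr_ge0)//.
rewrite !exprMn !sqr_sqrtr ?mulr_ge0 ?(ltW pi0)//.
rewrite -!expRM_natl.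
apply: (@le_trans _ _ (expR (2%:R * (- 2^-1)) *
   (((2 * c) `^ p * expR (- (2 * c))) * (c `^ (- p) * ((p - 1)^-1 + 4 / (p - 2) ^+ 2))))); last first.
  rewrite ler_pM2l ?expR_gt0//; apply: ler_pM => //.
    by rewrite mulr_ge0 ?powR_ge0 ?expR_ge0.
  rewrite mulr_ge0 ?powR_ge0// addr_ge0// ?invr_ge0 ?divr_ge0 ?sqr_ge0//; lra.
rewrite powRM//; last by lra.
have cp : c `^ p * c `^ (- p) = 1.
  by rewrite -powRD; [rewrite subrr powRr0|rewrite (gt_eqF c0) implybT].
rewrite (_ : expR (2%:R * (- 2^-1)) = (expR 1)^-1); last first.
  by rewrite -expRN; congr expR; lra.
rewrite (_ : - (2 * c) = 2%:R * - c); last by rewrite mulrN.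
set A := (p - 1)^-1 + _.
rewrite [leRHS](_ : _ = (expR 1)^-1 * expR (2%:R * - c) * (2 `^ p * A) * (c `^ p * c `^ (- p))); last by ring.
rewrite cp mulr1 [leRHS]mulrAC [leRHS]mulrC ler_pM2l ?expR_gt0//.
rewrite ler_pdivlMl ?expR_gt0// mulrC.
exact: powR2_ge.
Qed.

End first_arrival.

(** * Truncation error *)

Section conditionally_gaussian_sums.
Context d (T : measurableType d) (R : realType) (P : probability T R).
Variables (sigma : R) (W G : nat -> {RV P >-> R}).
Hypothesis sigma0 : 0 < sigma.
Hypothesis W_normal : forall (j : nat) (A : set R), measurable A ->
  distribution P (W j) A = normal_prob 0 sigma A.
Hypothesis W_independent : independent_RVs W.
Hypothesis W_G_independent : independent_families W G.
Local Notation N := (normal_prob 0 sigma).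

(** As the integral over [x] of an indicator on the product space, the function is measurable by
    Tonelli's theorem. *)
Lemma measurable_normal_scale (s : T -> R) (y : R) : measurable_fun setT s ->
  measurable_fun setT (fun v => N [set x | (s v * x <= y)%R]).
Proof.
move=> ms; pose f (p : R * T) : \bar R := (\1_(`]-oo, y]) (s p.2 * p.1))%:E.
have mf : measurable_fun setT f.
  apply/measurable_EFinP; apply: measurableT_comp; first exact: measurable_indic.
  by apply: measurable_funM => //; exact: (measurableT_comp ms).
rewrite (_ : (fun v => _) = (fun v => \int[N]_x f (x, v))%E).
  by apply: (@measurable_fun_fubini_tonelli_G _ _ _ _ _ N f) => // p; rewrite lee_fin.
apply/funext => v.
have mset : measurable [set x : R | s v * x <= y].
  have := measurable_affine_preimage (s v) 0 (measurable_itv `]-oo, y]).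
  by rewrite (_ : [set x | _] = [set x | s v * x <= y])//;
    apply/seteqP; split => x /=; rewrite in_itv/= addr0.
by rewrite -[X in N X](setIT [set x | _]) -integral_indic.
Qed.

(** [decoupling] freezes the arrivals, so that the weights become constants and [gaussian_sum_law]
    applies. General weights [a] cover the full and the truncated sum alike. *)
Lemma gaussian_mixture_cdf (a : nat -> R -> R) n (y : R) :
  (forall j, measurable_fun setT (a j)) -> (forall j x, 0 <= a j x) ->
  (P [set w | (\sum_(j < n) W j w * a j (G j w) <= y)%R] =
   \int[P]_v N [set x | (Num.sqrt (\sum_(j < n) a j (G j v) ^+ 2) * x <= y)%R])%E.
Proof.
move=> ma a0.
pose gen (F : nat -> {RV P >-> R}) :=
  \bigcup_(i in [set: nat]) preimage_set_system setT (F i) measurable.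
have mgen F : gen F `<=` measurable.
  by move=> _ [i _ [A mA <-]]; rewrite setTI; exact: measurable_funPTI.
have mF (F : nat -> {RV P >-> R}) i :
    measurable_fun setT (F i : g_sigma_algebraType (gen F) -> R).
  by move=> _ A mA; apply: sub_gen_smallest; exists i => //; exists A.
pose f (z : g_sigma_algebraType (gen W) * g_sigma_algebraType (gen G)) : \bar R :=
  (\1_(`]-oo, y]) (\sum_(j < n) W j z.1 * a j (G j z.2)))%:E.
have mf : measurable_fun setT f.
  apply/measurable_EFinP; apply: measurableT_comp; first exact: measurable_indic.
  apply: measurable_sum => j; apply: measurable_funM.
    exact: (measurableT_comp (mF W j)).
  by apply: (measurableT_comp (ma j)); exact: (measurableT_comp (mF G j)).
have f0 z : (0 <= f z)%E by rewrite lee_fin.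
have dec := decoupling (mgen W) (mgen G) W_G_independent mf f0.
have msum (b : nat -> T -> R) : (forall j, measurable_fun setT (b j)) ->
    measurable [set w | \sum_(j < n) W j w * b j w <= y].
  move=> mb; have ms : measurable_fun setT (fun w => \sum_(j < n) W j w * b j w).
    by apply: measurable_sum => j; exact: measurable_funM.
  have := ms measurableT `]-oo, y]%classic (measurable_itv _).
  by rewrite setTI.
rewrite -[X in P X](setIT [set w | _]) -integral_indic//; last first.
  apply: (msum (fun j w => a j (G j w))) => j.
  exact: measurableT_comp (ma j) (measurable_funPT (G j)).
transitivity (\int[P]_w f (w, w))%E.
  by apply: eq_integral => w _; rewrite /f/= !indicE.
rewrite dec; apply: eq_integral => v _.
have := gaussian_sum_law sigma0 W_normal W_independent (a := fun j => a j (G j v)) n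
  (fun j => a0 j _) (measurable_itv `]-oo, y]).
rewrite (_ : [set w | _] = [set w | \sum_(j < n) W j w * a j (G j v) <= y]); last first.
  by apply/seteqP; split => w /=; rewrite in_itv.
rewrite (_ : [set x | `]-oo, y]%classic (Num.sqrt _ * x)] =
    [set x | Num.sqrt (\sum_(j < n) a j (G j v) ^+ 2) * x <= y]); last first.
  by apply/seteqP; split => w /=; rewrite in_itv.
move=> <-; rewrite -[X in P X](setIT [set w | _]) -integral_indic//; last first.
  by apply: (msum (fun j _ => a j (G j v))) => j; exact: measurable_cst.
Qed.

End conditionally_gaussian_sums.

Lemma cauchy_schwarz_integral d (T : measurableType d) (R : realType)
    (mu : {measure set T -> \bar R}) (f g : T -> R) (A B : R) :
  measurable_fun setT f -> measurable_fun setT g ->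
  (forall w, 0 <= f w) -> (forall w, 0 <= g w) -> 0 < A -> 0 < B ->
  (\int[mu]_w (f w ^+ 2)%:E <= A%:E)%E -> (\int[mu]_w (g w ^+ 2)%:E <= B%:E)%E ->
  (\int[mu]_w (f w * g w)%:E <= (Num.sqrt (A * B))%:E)%E.
Proof.
move=> mf mg f0 g0 A0 B0 fA gB.
(* This [l] minimises l A / 2 + B / (2 l), with minimum sqrt(A B); the inequality f g <= l f^2 / 2 +
   g^2 / (2 l) is then integrated. *)
pose l := Num.sqrt B / Num.sqrt A.
have sA : 0 < Num.sqrt A by rewrite sqrtr_gt0.
have sB : 0 < Num.sqrt B by rewrite sqrtr_gt0.
have l0 : 0 < l by rewrite divr_gt0.
have mf2 : measurable_fun setT (fun w => (f w ^+ 2)%:E).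
  by apply/measurable_EFinP; exact: measurable_funX.
have mg2 : measurable_fun setT (fun w => (g w ^+ 2)%:E).
  by apply/measurable_EFinP; exact: measurable_funX.
have c1 : 0 <= l / 2 by rewrite divr_ge0// ltW.
have c2 : 0 <= l^-1 / 2 by rewrite divr_ge0// invr_ge0 ltW.
apply: (@le_trans _ _ (\int[mu]_w ((l / 2)%:E * (f w ^+ 2)%:E +
    (l^-1 / 2)%:E * (g w ^+ 2)%:E))%E).
  apply: ge0_le_integral => //=.
  - by move=> w _; rewrite lee_fin mulr_ge0.
  - by apply/measurable_EFinP; exact: measurable_funM.
  - by apply: emeasurable_funD; exact: emeasurable_funM.
  - move=> w _; rewrite -!EFinM -EFinD lee_fin.
    rewrite -subr_ge0 (_ : _ - _ = (l * f w - g w) ^+ 2 * (l^-1 / 2)); last first.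
      by field; rewrite gt_eqF.
    by rewrite mulr_ge0 ?sqr_ge0.
rewrite ge0_integralD//; last 4 first.
- by move=> w _; rewrite -EFinM lee_fin mulr_ge0 ?sqr_ge0.
- exact: emeasurable_funM.
- by move=> w _; rewrite -EFinM lee_fin mulr_ge0 ?sqr_ge0.
- exact: emeasurable_funM.
rewrite !ge0_integralZl//; try by move=> w _; rewrite lee_fin sqr_ge0.
apply: (@le_trans _ _ ((l / 2)%:E * A%:E + (l^-1 / 2)%:E * B%:E)%E).
  by apply: leeD; apply: lee_wpmul2l.
rewrite -!EFinM -EFinD lee_fin le_eqVlt; apply/orP; left; apply/eqP.
rewrite sqrtrM ?(ltW A0)// /l.
have AE : A = Num.sqrt A ^+ 2 by rewrite sqr_sqrtr// ltW.
have BE : B = Num.sqrt B ^+ 2 by rewrite sqr_sqrtr// ltW.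
rewrite {2}AE {3}BE; field.
by rewrite !gt_eqF.
Qed.

Section truncation.
Context d (T : measurableType d) (R : realType) (P : probability T R).
Variables (alpha sigmaW c : R) (W G : nat -> {RV P >-> R}).
Hypothesis alpha_gt0 : 0 < alpha.
Hypothesis alpha_lt2 : alpha < 2.
Hypothesis sigmaW_gt0 : 0 < sigmaW.
Hypothesis c_gt1 : 1 < c.
Hypothesis G_poisson : unit_poisson_arrivals G.
Hypothesis W_normal : forall (j : nat) (A : set R), measurable A ->
  distribution P (W j) A = normal_prob 0 sigmaW A.
Hypothesis W_independent : independent_RVs W.
Hypothesis W_G_independent : independent_families W G.
Local Notation N := (normal_prob 0 sigmaW).
Local Notation K := (expR (- 2^-1) / Num.sqrt (2 * pi) : R).

Let q := 2 / alpha.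
Let p := 4 / alpha.
Let M := c `^ (1 - 2 * q) / (2 * q - 1) + (c `^ (1 - q) / (q - 1)) ^+ 2.
Let a (x : R) := x `^ (- alpha^-1).
(** The truncation is moved into the weight, so [S'] is a sum over the same [n] Gaussian variables
    as [S]. The interval is unbounded below because the arrivals are almost surely positive. *)
Let b (x : R) := a x * \1_(`]-oo, c]) x.
Let S n w := \sum_(j < n) W j w * a (G j w).
Let S' n w := \sum_(j < n) W j w * b (G j w).
Let tail n w := arrival_sum G q `]c, +oo[ n w.

Let c0 : 0 < c. Proof. exact: lt_trans c_gt1. Qed.
Let q1 : 1 < q. Proof. by rewrite /q ltr_pdivlMr// mul1r. Qed.
Let pE : p = 2 * q. Proof. by rewrite /p /q; lra. Qed.
Let p2 : 2 < p. Proof. by rewrite pE; have := q1; lra. Qed.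
Let K0 : 0 < K.
Proof. by rewrite divr_gt0 ?expR_gt0// sqrtr_gt0 mulr_gt0// pi_gt0. Qed.
Let M0 : 0 < M.
Proof.
have := q1 => q1'.
by rewrite ltr_wpDr ?sqr_ge0// divr_gt0 ?powR_gt0//; lra.
Qed.

Let truncation_boundE : truncation_bound c alpha =
  K * Num.sqrt (Gamma_fun (p + 1) * M).
Proof.
have an : alpha != 0 by rewrite gt_eqF.
have h2 : 2 - alpha != 0 by rewrite subr_eq0 gt_eqF.
have h4 : 4 - alpha != 0 by apply/negP => /eqP; have := alpha_lt2; lra.
rewrite /truncation_bound /M /p /q.
have -> : (alpha + 4) / alpha = 4 / alpha + 1 by field.
have -> : (alpha - 4) / alpha = 1 - 2 * (2 / alpha) by field.
have -> : (alpha - 2) / alpha = 1 - 2 / alpha by field.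
have -> : alpha / (4 - alpha) = (2 * (2 / alpha) - 1)^-1.
  rewrite (_ : 2 * (2 / alpha) - 1 = (4 - alpha) / alpha); last by field.
  by rewrite invf_div.
have -> : alpha / (2 - alpha) = (2 / alpha - 1)^-1.
  rewrite (_ : 2 / alpha - 1 = (2 - alpha) / alpha); last by field.
  by rewrite invf_div.
by rewrite ![_^-1 * _]mulrC.
Qed.

Let ma : measurable_fun setT a.
Proof. exact: measurable_powR. Qed.

Let mb : measurable_fun setT b.
Proof. by apply: measurable_funM => //; exact: measurable_indic. Qed.

Let a0 x : 0 <= a x. Proof. exact: powR_ge0. Qed.
Let b0 x : 0 <= b x. Proof. by rewrite mulr_ge0. Qed.

Let a_sqr x : a x ^+ 2 = x `^ (- q).
Proof.
by rewrite /a /q -powR_mulrn ?powR_ge0// -powRrM; congr (_ `^ _); field; rewrite gt_eqF.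
Qed.

(* The first term accounts for [G 0 <= c], the second one for [c < G 0], in which
   case the truncated sum vanishes. *)
Let error n v : R := K / 2 * (G 0%N v `^ q * tail n v) + 2^-1 * \1_(`]c, +oo[) (G 0%N v).

Let tail_ge0 n v : 0 <= tail n v. Proof. exact: arrival_sum_ge0. Qed.

Let mtail n : measurable_fun setT (tail n).
Proof. by apply: measurable_arrival_sum; exact: measurable_itv. Qed.

Let mG0q : measurable_fun setT (fun v => G 0%N v `^ q).
Proof. by apply: (measurableT_comp (f := @powR R ^~ q)). Qed.

Let merror n : measurable_fun setT (error n).
Proof.
apply: measurable_funD; apply: measurable_funM => //; first exact: measurable_funM.
by apply: measurableT_comp => //; exact: measurable_indic.
Qed.

Let error_ge0 n v : 0 <= error n v.
Proof.
by rewrite addr_ge0 ?mulr_ge0 ?powR_ge0 ?tail_ge0 ?divr_ge0 ?(ltW K0).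
Qed.

Let V n v := \sum_(j < n) a (G j v) ^+ 2.
Let V' n v := \sum_(j < n) b (G j v) ^+ 2.

Let V_split n v : V n v = V' n v + tail n v.
Proof.
rewrite /V /V' /tail /arrival_sum -big_split/=; apply: eq_bigr => j _.
rewrite /b exprMn a_sqr !indicE !mem_setE !in_itv/= andbT ltNge.
by case: (_ <= _); rewrite /= ?expr0n ?expr1n ?mulr1 ?mul0r ?mulr0 ?addr0 ?add0r ?mul1r.
Qed.

Let conditional_cdf_le n y v : (0 < n)%N ->
  (forall j, 0 < G j v) -> (forall i j, (i <= j)%N -> G i v <= G j v) ->
  (N [set x | (Num.sqrt (V n v) * x <= y)%R] <=
    N [set x | (Num.sqrt (V' n v) * x <= y)%R] + (error n v)%:E)%E /\
  (N [set x | (Num.sqrt (V' n v) * x <= y)%R] <=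
    N [set x | (Num.sqrt (V n v) * x <= y)%R] + (error n v)%:E)%E.
Proof.
move=> n0 Gp Gmono.
have V'0 : 0 <= V' n v by apply: sumr_ge0 => j _; exact: sqr_ge0.
have V0 : 0 <= V n v by apply: sumr_ge0 => j _; exact: sqr_ge0.
have [Gc|cG] := leP (G 0%N v) c.
- have errE : error n v = K / 2 * (G 0%N v `^ q * tail n v).
    by rewrite /error indicE mem_setE in_itv/= andbT ltNge Gc mulr0 addr0.
  (* As [0 < n], the first arrival is among the terms of [V' n v], and its own term gives the lower
     bound. *)
  have V'ge : G 0%N v `^ (- q) <= V' n v.
    rewrite /V'; case: n n0 {V'0 V0 errE} => // n _.
    rewrite big_ord_recl/= /b exprMn a_sqr indicE mem_setE in_itv/= Gc expr1n mulr1.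
    by rewrite lerDl; apply: sumr_ge0 => j _; exact: sqr_ge0.
  have V'p : 0 < V' n v by apply: lt_le_trans V'ge; exact: powR_gt0.
  have su : 0 < Num.sqrt (V' n v) by rewrite sqrtr_gt0.
  have suv : Num.sqrt (V' n v) <= Num.sqrt (V n v).
    by rewrite ler_sqrt// V_split lerDl.
  have [h1 h2] := normal_cdf_scale_le sigmaW_gt0 y su suv.
  have le_err : K * ((Num.sqrt (V n v) ^+ 2 - Num.sqrt (V' n v) ^+ 2) /
      Num.sqrt (V' n v) ^+ 2 / 2) <= error n v.
    rewrite !sqr_sqrtr// errE V_split addrAC subrr add0r.
    rewrite [leLHS](_ : _ = K / 2 * (tail n v / V' n v)); last by ring.
    rewrite ler_pM2l; last by rewrite divr_gt0 ?K0.
    rewrite mulrC ler_wpM2r//.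
    by rewrite -[leRHS]invrK -powRN lef_pV2// posrE powR_gt0.
  by split; [apply: le_trans h1 _|apply: le_trans h2 _]; rewrite leeD2l// lee_fin.
- have errge : 2^-1 <= error n v.
    rewrite /error indicE mem_setE in_itv/= andbT cG mulr1 lerDr.
    by rewrite !mulr_ge0 ?powR_ge0 ?divr_ge0 ?(ltW K0).
  have -> : V' n v = 0.
    apply: big1 => j _; rewrite /b indicE mem_setE in_itv/= leNgt.
    by rewrite (lt_le_trans cG (Gmono _ _ (leq0n j))) mulr0 expr0n.
  rewrite sqrtr0.
  have [h1 h2] := normal_cdf_degenerate_le sigmaW_gt0 y (sqrtr_ge0 (V n v)).
  by split; [apply: le_trans h1 _|apply: le_trans h2 _]; rewrite leeD2l// lee_fin.
Qed.

Let expected_error_le n :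
  (\int[P]_v (error n v)%:E <= (truncation_bound c alpha)%:E)%E.
Proof.
have G0 : 0 < Gamma_fun (p + 1) :> R.
  apply: lt_le_trans (Gamma_fun_ge G_poisson _ (ltW c0)); last by have := p2; lra.
  by rewrite mulr_gt0 ?powR_gt0 ?expR_gt0.
have mc : measurable [set v | c < G 0%N v].
  rewrite (_ : [set w | _] = G 0%N @^-1` `]c, +oo[); first exact: measurable_funPTI.
  by apply/seteqP; split => w /=; rewrite in_itv/= andbT.
have mGt : measurable_fun setT (fun v => (G 0%N v `^ q * tail n v)%:E).
  by apply/measurable_EFinP; exact: measurable_funM.
have mi : measurable_fun setT (fun v => (\1_[set v | c < G 0%N v] v)%:E : \bar R).
  by apply/measurable_EFinP; exact: measurable_indic.
have Gt0 v : (0 <= (G 0%N v `^ q * tail n v)%:E)%E.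
  by rewrite lee_fin mulr_ge0 ?powR_ge0.
have KK : 0 <= K / 2 by rewrite divr_ge0 ?(ltW K0).
rewrite [leLHS](_ : _ = \int[P]_v ((K / 2)%:E * (G 0%N v `^ q * tail n v)%:E +
    (2^-1)%:E * (\1_[set v | c < G 0%N v] v)%:E))%E; last first.
  apply: eq_integral => v _; rewrite -!EFinM -EFinD /error !indicE.
  congr ((_ + _ * (_ : bool)%:R)%:E); apply: asbool_equiv_eq.
  by rewrite /= in_itv/= andbT.
rewrite ge0_integralD//; last 3 first.
- by move=> v _; rewrite mule_ge0// lee_fin.
- exact: emeasurable_funM.
- exact: emeasurable_funM.
rewrite !ge0_integralZl//; try by rewrite lee_fin.
rewrite integral_indic// setIT.
have tailc := first_arrival_tail G_poisson (ltW c0).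
have cs : (\int[P]_v (G 0%N v `^ q * tail n v)%:E <=
    (Num.sqrt (Gamma_fun (p + 1) * M))%:E)%E.
  apply: cauchy_schwarz_integral => //.
  - by move=> v; exact: powR_ge0.
  - rewrite -(first_arrival_moment G_poisson); last by have := p2; lra.
    rewrite le_eqVlt; apply/orP; left; apply/eqP.
    apply: eq_integral => v _; congr EFin.
    by rewrite -powR_mulrn ?powR_ge0// -powRrM pE mulrC.
  - exact: arrival_tail_sum_moment2.
apply: (@le_trans _ _ ((K / 2)%:E * (Num.sqrt (Gamma_fun (p + 1) * M))%:E +
    (2^-1)%:E * (expR (- c))%:E)%E).
  by rewrite -tailc leeD2r// lee_wpmul2l.
rewrite -!EFinM -EFinD lee_fin truncation_boundE.
have := void_probability_le G_poisson c_gt1 p2.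
rewrite (_ : p / 2 = q); last by rewrite pE; lra.
rewrite [in X in 1 - X]pE [in X in X - 1]pE -/M => vp.
by move: vp; set z := Num.sqrt (_ * _); set k := K; lra.
Qed.

Let mVsqrt n (f : R -> R) : measurable_fun setT f ->
  measurable_fun setT (fun v => Num.sqrt (\sum_(j < n) f (G j v) ^+ 2)).
Proof.
move=> mf; have msqrt : measurable_fun setT (fun x : R => Num.sqrt x).
  by apply: continuous_measurable_fun => x; exact: sqrt_continuous.
apply: (measurableT_comp msqrt).
by apply: measurable_sum => j; apply: measurable_funX; exact: measurableT_comp.
Qed.

(** The conditional estimate is integrated over the arrivals. Its bound depends neither on [n] nor
    on [y], so it survives the limit. *)
Let partial_sums_cdf_le n y : (0 < n)%N ->
  (P [set w | (S n w <= y)%R] <=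
    P [set w | (S' n w <= y)%R] + (truncation_bound c alpha)%:E)%E /\
  (P [set w | (S' n w <= y)%R] <=
    P [set w | (S n w <= y)%R] + (truncation_bound c alpha)%:E)%E.
Proof.
move=> n0.
rewrite (gaussian_mixture_cdf sigmaW_gt0 W_normal W_independent W_G_independent
  (a := fun=> a))//.
rewrite (gaussian_mixture_cdf sigmaW_gt0 W_normal W_independent W_G_independent
  (a := fun=> b))//.
have mN (f : R -> R) : measurable_fun setT f -> measurable_fun setT
    (fun v => N [set x | (Num.sqrt (\sum_(j < n) f (G j v) ^+ 2) * x <= y)%R]).
  by move=> mf; apply: measurable_normal_scale; exact: mVsqrt.
have me : measurable_fun setT (fun v => (error n v)%:E) by exact/measurable_EFinP.
have e0 v : (0 <= (error n v)%:E)%E by rewrite lee_fin.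
have good := ae_arrivals_positive G_poisson.
split.
- apply: (@le_trans _ _ (\int[P]_v (N [set x | (Num.sqrt (V' n v) * x <= y)%R] +
      (error n v)%:E))%E); last first.
    rewrite ge0_integralD//; last exact: mN.
    by rewrite leeD2l//; exact: expected_error_le.
  apply: ae_ge0_le_integral => //.
  + exact: mN.
  + by move=> v _; rewrite adde_ge0.
  + by apply: emeasurable_funD => //; exact: mN.
  + apply: filterS good => v [Gp Gmono] _.
    by have [] := conditional_cdf_le y n0 Gp Gmono.
- apply: (@le_trans _ _ (\int[P]_v (N [set x | (Num.sqrt (V n v) * x <= y)%R] +
      (error n v)%:E))%E); last first.
    rewrite ge0_integralD//; last exact: mN.
    by rewrite leeD2l//; exact: expected_error_le.
  apply: ae_ge0_le_integral => //.
  + exact: mN.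
  + by move=> v _; rewrite adde_ge0.
  + by apply: emeasurable_funD => //; exact: mN.
  + apply: filterS good => v [Gp Gmono] _.
    by have [] := conditional_cdf_le y n0 Gp Gmono.
Qed.

(** Almost surely finitely many arrivals are at most [c], and [S' n w] is constant once [n] has
    passed the last of them. *)
Let S'_cvg : {ae P, forall w,
  S' n w @[n --> \oo] --> truncated_poisson_series W G alpha c w}.
Proof.
apply: filterS2 (ae_arrivals_positive G_poisson)
  (ae_arrivals_locally_finite G_poisson c0) => w [Gp _] fin.
have S'E n : S' n w = \sum_(j < n | 0 <= G j w <= c) poisson_series_term W G alpha j w.
  rewrite /S' [RHS]big_mkcond/=; apply: eq_bigr => j _.
  rewrite /b /poisson_series_term indicE mem_setE in_itv/= (ltW (Gp j))/=.
  by case: ifP => _; rewrite ?mulr1// ?mulr0 ?mulr0.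
have [n0 hn0] : exists n0, forall j, 0 <= G j w <= c -> (j < n0)%N.
  have /finite_seqP[s Ss] := fin.
  exists (\max_(i <- s) i).+1 => j Gj.
  have : [set` s] j by rewrite -Ss.
  by move=> /= js; rewrite ltnS leq_bigmax_seq.
apply: cvg_near_cst; exists n0 => // n /= n0n; rewrite S'E.
rewrite /truncated_poisson_series fsbig_mkcond (fsbigE (iota 0 n)) ?iota_uniq//; last first.
  move=> j _; rewrite mem_iota add0n/= => jn; rewrite patchE memNset//= => Gj.
  by move/negP: jn; apply; exact: leq_trans (hn0 j Gj) n0n.
rewrite big_mkcond/= -(big_mkord xpredT
  (fun j => if 0 <= G j w <= c then poisson_series_term W G alpha j w else 0)).
rewrite /index_iota subn0; apply: eq_big => [j|j _]; first by rewrite in_setT.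
by rewrite patchE mem_setE.
Qed.

Lemma kolmogorov_distance_truncation (X : {RV P >-> R}) :
  {ae P, forall w, series (poisson_series_term W G alpha ^~ w) n @[n --> \oo] --> X w} ->
  (kolmogorov_distance X (truncated_poisson_series W G alpha c)
     <= (truncation_bound c alpha)%:E)%E.
Proof.
move=> X_series.
have S_cvg : {ae P, forall w, S n w @[n --> \oo] --> X w}.
  apply: filterS X_series => w; rewrite (_ : series _ = S ^~ w)//.
  by apply/funext => n; rewrite /series/= big_mkord.
have mS n : measurable_fun setT (S n).
  by apply: measurable_sum => j; apply: measurable_funM => //; exact: measurableT_comp.
have mS' n : measurable_fun setT (S' n).
  by apply: measurable_sum => j; apply: measurable_funM => //; exact: measurableT_comp.
pose Y : {RV P >-> R} := truncated_poisson_series W G alpha c.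
(* The passage to the limit is one-sided, hence applied twice with the two sums exchanged. *)
have le1 := cdf_le_ae_limit (Y := Y) (b := truncation_bound c alpha) mS mS'
  (measurable_funPT X) S_cvg S'_cvg.
have le2 := cdf_le_ae_limit (Y := X) (b := truncation_bound c alpha) mS' mS
  (measurable_funPT Y) S'_cvg S_cvg.
have {le1}/le1 le1 : \forall n \near \oo, forall y, (P [set w | (S n w <= y)%R] <=
    P [set w | (S' n w <= y)%R] + (truncation_bound c alpha)%:E)%E.
  by exists 1%N => // n n0 y; have [] := partial_sums_cdf_le y n0.
have {le2}/le2 le2 : \forall n \near \oo, forall y, (P [set w | (S' n w <= y)%R] <=
    P [set w | (S n w <= y)%R] + (truncation_bound c alpha)%:E)%E.
  by exists 1%N => // n n0 y; have [] := partial_sums_cdf_le y n0.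
have cdfE (Z : {RV P >-> R}) y : cdf Z y = P [set w | (Z w <= y)%R].
  by rewrite /cdf /distribution /pushforward; congr (P _);
    apply/seteqP; split => w /=; rewrite in_itv.
apply: ge_ereal_sup => _ [x _ <-].
rewrite !cdfE.
have := le2 x; have := le1 x.
have mle (Z : {RV P >-> R}) : measurable [set w | Z w <= x].
  rewrite (_ : [set w | _] = Z @^-1` `]-oo, x]); first exact: measurable_funPTI.
  by apply/seteqP; split => w /=; rewrite in_itv.
have fX : P [set w | X w <= x] \is a fin_num by exact: fin_num_measure (mle X).
have fY : P [set w | Y w <= x] \is a fin_num by exact: fin_num_measure (mle Y).
rewrite -(fineK fX) -(fineK fY) -!EFinD /= !lee_fin => h1 h2.
by rewrite ler_norml; lra.
Qed.

End truncation.

Theorem proposition6 (R : realType) (d : measure_display)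
    (T : measurableType d) (P : probability T R)
    (alpha sigmaW c : R) (W G : nat -> {RV P >-> R}) (X : {RV P >-> R})
    (alpha_gt0 : 0 < alpha) (alpha_lt2 : alpha < 2) (alpha_neq1 : alpha != 1)
    (sigmaW_gt0 : 0 < sigmaW) (c_gt1 : 1 < c)
    (G_poisson : unit_poisson_arrivals G)
    (W_normal : forall (j : nat) (A : set R), measurable A ->
      distribution P (W j) A = normal_prob 0 sigmaW A)
    (W_independent : independent_RVs W)
    (W_G_independent : independent_families W G)
    (X_series : {ae P, forall w,
      series (poisson_series_term W G alpha ^~ w) n @[n --> \oo] --> X w}) :
  (kolmogorov_distance X (truncated_poisson_series W G alpha c)
     <= (truncation_bound c alpha)%:E)%E.
Proof.
exact: (kolmogorov_distance_truncation alpha_gt0 alpha_lt2 sigmaW_gt0 c_gt1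
  G_poisson W_normal W_independent W_G_independent X_series).
Qed.
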